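(* Let $z_1,\dots,z_N$ be points in the unit ball $\mathbb{B}_m\subset\mathbb{C}^m$. (1) There exists a unique (up to a linear unitary transformation) holomorphic automorphism $p$ of the unit ball onto itself such that $$\sum_{k=1}^N p(z_k)=0.$$ (2) Decompose the automorphism $p$ as $p=U\circ p_c$ for a certain $c\in\mathbb{B}_m$ and a linear unitary transformation $U$ of the unit ball. Then the point $c$ is the unique minimum of the function $$L_N(z)=-\sum_{i=1}^N\log\frac{(1-|z|^2)(1-|z_i|^2)}{|1-\langle z,z_i\rangle|^2},\qquad z\in\mathbb{B}_m.$$
   Context: On $\mathbb{C}^m$, $\langle z,w\rangle=\sum_{k=1}^m z_k\overline{w_k}$ and $|z|=\sqrt{\langle z,z\rangle}$; $\mathbb{B}_m=\{z\in\mathbb{C}^m:|z|<1\}$; $N\ge1$ is an integer. For $a\in\mathbb{B}_m$, $$p_a(z)=\frac{a-P_az-s_aQ_az}{1-\langle z,a\rangle},$$ where $P_0=0$ and $P_az=\frac{\langle z,a\rangle}{\langle a,a\rangle}a$ for $a\neq0$, $Q_a=I-P_a$, $s_a=(1-|a|^2)^{1/2}$. Every holomorphic automorphism of $\mathbb{B}_m$ has the form $U\circ p_a$ with $U$ unitary and $a\in\mathbb{B}_m$. ''Unique up to a linear unitary transformation'' means that any two such automorphisms $p,\tilde p$ satisfy $\tilde p=U\circ p$ for some unitary $U$. *)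

(* Defs.v *)
From HB Require Import structures.
From mathcomp Require Import all_boot all_order all_algebra.
From mathcomp Require Import all_classical all_reals all_analysis.
From mathcomp.real_closed Require Export complex.

Set Implicit Arguments.
Unset Strict Implicit.
Unset Printing Implicit Defensive.

Import Order.TTheory GRing.Theory Num.Theory.
Import numFieldNormedType.Exports.

Local Open Scope classical_set_scope.
Local Open Scope ring_scope.

(* MathComp(-Analysis) reals and topology. The complex numbers are R[i] for
   R : realType, and points of C^m are column vectors, so that an m x m matrix
   U acts linearly by z |-> U *m z. *)

Section UnitBall.
Variables (R : realType) (m : nat).
Local Notation C := R[i].
Implicit Types (z w a : 'cV[C]_m) (p q : 'cV[C]_m -> 'cV[C]_m).

Definition inner z w : C := \sum_(k < m) z k 0 * (w k 0)^*.

(* The norm `|z| that the library puts on matrices is the sup norm, hence this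
   separate Euclidean norm; inner z z is a real number, and Re reads it in R. *)
Definition enorm z : R := Num.sqrt (complex.Re (inner z z)).

Definition unit_ball : set 'cV[C]_m := [set z | enorm z < 1].

(* Complex (Frechet) differentiability: the scalar field is R[i]. All norms on
   C^m are equivalent, so the sup norm gives the usual notion. *)
Definition holomorphic_on (A : set 'cV[C]_m) p : Prop :=
  forall z, A z -> differentiable p (z : ('cV[C]_m : normedModType C)).

(* Maps are total functions on C^m; only their values on the ball matter. *)
Definition ball_automorphism p : Prop :=
  exists q,
    [/\ forall z, unit_ball z -> unit_ball (p z) /\ unit_ball (q z),
        forall z, unit_ball z -> q (p z) = z /\ p (q z) = z,
        holomorphic_on unit_ball p
      & holomorphic_on unit_ball q].

Definition ball_proj a z : 'cV[C]_m :=
  if a == 0 then 0 else (inner z a / inner a a) *: a.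

Definition ball_coproj a z : 'cV[C]_m := z - ball_proj a z.

Definition ball_scale a : R := Num.sqrt (1 - enorm a ^+ 2).

Definition ball_mobius a z : 'cV[C]_m :=
  (1 - inner z a)^-1 *:
    (a - ball_proj a z - (ball_scale a)%:C%C *: ball_coproj a z).

Definition log_barycenter_fun (N : nat) (zs : 'I_N -> 'cV[C]_m) z : R :=
  - \sum_(i < N) ln ((1 - enorm z ^+ 2) * (1 - enorm (zs i) ^+ 2)
                     / Normc.normc (1 - inner z (zs i)) ^+ 2).

Definition unique_minimizer (A : set 'cV[C]_m) (L : 'cV[C]_m -> R) c : Prop :=
  [/\ A c,
      forall z, A z -> L c <= L z
    & forall z, A z -> (forall w, A w -> L z <= L w) -> z = c].

End UnitBall.

(* Main.v *)
(* For [p = U o p_c] the condition [sum_k p (z_k) = 0] reads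
   [sum_k p_c (z_k) = 0], and [L_N] is invariant under automorphisms, so
   everything reduces to the points [y_k = p_c (z_k)] and the center 0.  Up to a
   constant, [L_N w] for the [y_k] is
   [sum_k ln (|1 - <w, y_k>|^2 / (1 - |w|^2))]; by strict concavity of [ln] each
   term with [w <> 0] lies strictly above a negative multiple of
   [Re <w, y_k>], so [sum_k y_k = 0] makes 0 the strict minimum.  Conversely,
   [L_N] blows up at the boundary, hence has a minimum, and there the first
   variation forces [sum_k y_k = 0].

   It remains that every automorphism is some [U o p_c], i.e. that an
   automorphism [f] with [f 0 = 0] is unitary.  Goursat's argument in polar
   coordinates gives [|h' 0| <= 1] for a holomorphic self-map [h] of the disc
   fixing 0; transporting this by Moebius maps and integrating along a radius
   gives the Schwarz lemma, so [f] preserves [|p_a z|] and hence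
   [|1 - <z, a>|].  Comparing first order terms at 0 shows
   [<f' 0 v, f a> = <v, a>], so that [f = f' 0] is unitary. *)

Require Import Defs.
From HB Require Import structures.
From mathcomp Require Import all_boot all_order all_algebra.
From mathcomp Require Import all_classical all_reals all_analysis.
From mathcomp Require Import ring lra.

Set Implicit Arguments.
Unset Strict Implicit.
Unset Printing Implicit Defensive.

Import Order.TTheory GRing.Theory Num.Theory.
Import numFieldNormedType.Exports.

Local Open Scope ring_scope.

(** * Goursat's lemma for a real field on a rectangle *)

Section Goursat.
Local Open Scope classical_set_scope.
Local Open Scope ring_scope.
Variable R : realType.

(** The fundamental theorem of calculus gives the derivative at interior points only, so a primitive
    on a closed interval is taken from a slightly larger one. *)
Lemma primitive_exists (f : R -> R) (a b : R) : a < b ->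
  (forall x, a <= x <= b -> {for x, continuous f}) ->
  exists F : R -> R, forall x, a < x < b -> is_derive x 1 F (f x).
Proof.
move=> ab cf.
exists (fun x => \int[lebesgue_measure]_(t in `[a, x]) (f t))%R => x /andP[ax xb].
have fi : lebesgue_measure.-integrable `[a, b] (EFin \o f).
  apply: continuous_compact_integrable; first exact: segment_compact.
  apply: continuous_in_subspaceT => y; rewrite inE/= in_itv/=; exact: cf.
have cx : {for x, continuous f} by apply: cf; rewrite !ltW.
have [dF F'] := @continuous_FTC1_closed R f a x b xb fi ax cx.
rewrite -F' derive1E.
exact: derivableP.
Qed.

(** Were [P] to fail, some quarter would fail at every stage; the nested failing quarters shrink to
    a point [(p, q)], where the local hypothesis refutes them. The index [n] counts the halvings of
    the sides. *)
Lemma rectangle_bisection (P : R -> R -> nat -> Prop) (x0 y0 w h : R) :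
  0 <= w -> 0 <= h ->
  let w_ n := w / 2 ^+ n in let h_ n := h / 2 ^+ n in
  (forall x y n, P x y n.+1 -> P (x + w_ n.+1) y n.+1 ->
     P x (y + h_ n.+1) n.+1 -> P (x + w_ n.+1) (y + h_ n.+1) n.+1 -> P x y n) ->
  (forall p q, x0 <= p <= x0 + w -> y0 <= q <= y0 + h ->
     exists2 d, 0 < d & forall x y n, x0 <= x -> x + w_ n <= x0 + w ->
       y0 <= y -> y + h_ n <= y0 + h -> x <= p <= x + w_ n ->
       y <= q <= y + h_ n -> w_ n < d -> h_ n < d -> P x y n) ->
  P x0 y0 0%N.
Proof.
move=> w0 h0 w_ h_ step loc; apply: contrapT => nP.
have halfE (z : R) n : z / 2 ^+ n = z / 2 ^+ n.+1 + z / 2 ^+ n.+1.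
  by rewrite exprS invfM; field; rewrite expf_neq0.
(* [g] picks a failing quarter of a failing rectangle; its value elsewhere is arbitrary. *)
have /choice[g gP] : forall ns : nat * (R * R), exists s : R * R,
    ~ P ns.2.1 ns.2.2 ns.1 -> [/\ ~ P s.1 s.2 ns.1.+1,
     s.1 = ns.2.1 \/ s.1 = ns.2.1 + w_ ns.1.+1 &
     s.2 = ns.2.2 \/ s.2 = ns.2.2 + h_ ns.1.+1].
  move=> [n [x y]] /=.
  have [Q|Q] := pselect (P x y n); first by exists (0, 0).
  apply: contrapT => /forallNP H; apply: Q; apply: step.
  - apply: contrapT => Q; apply: (H (x, y)) => _.
    by split => //=; left.
  - apply: contrapT => Q; apply: (H (x + w_ n.+1, y)) => _.
    by split => //=; [right|left].
  - apply: contrapT => Q; apply: (H (x, y + h_ n.+1)) => _.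
    by split => //=; [left|right].
  - apply: contrapT => Q; apply: (H (x + w_ n.+1, y + h_ n.+1)) => _.
    by split => //=; right.
pose s := fix s n := if n is k.+1 then g (k, s k) else (x0, y0).
have sP n : ~ P (s n).1 (s n).2 n.
  by elim: n => [//|n IH] /=; case: (gP (n, s n) IH).
have w_0 n : 0 <= w_ n by rewrite divr_ge0// exprn_ge0.
have h_0 n : 0 <= h_ n by rewrite divr_ge0// exprn_ge0.
have nested (t z_ : nat -> R) : (forall n, 0 <= z_ n) ->
    (forall n, z_ n = z_ n.+1 + z_ n.+1) ->
    (forall n, t n.+1 = t n \/ t n.+1 = t n + z_ n.+1) ->
    (forall n, t 0%N <= t n /\ t n + z_ n <= t 0%N + z_ 0%N) /\
    exists p, forall n, t n <= p <= t n + z_ n.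
  move=> z0 zE tE.
  have inc n : t n <= t n.+1 /\ t n.+1 + z_ n.+1 <= t n + z_ n.
    have := z0 n.+1; have := zE n; case: (tE n) => ->; lra.
  have incD n k : t n <= t (n + k)%N /\ t (n + k)%N + z_ (n + k)%N <= t n + z_ n.
    elim: k => [|k [IH1 IH2]]; first by rewrite addn0.
    by rewrite addnS; case: (inc (n + k)%N) => i1 i2; split;
      [apply: le_trans i1|apply: le_trans i2 _].
  split; first by move=> n; have := incD 0%N n; rewrite add0n.
  have le_t n k : t n <= t k + z_ k.
    have [nk|/ltnW kn] := leqP n k.
      have := (incD n (k - n)%N).1; rewrite subnKC// => /le_trans; apply.
      by rewrite lerDl.
    have := (incD k (n - k)%N).2; rewrite subnKC// => /(le_trans _); apply.
    by rewrite lerDl.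
  have ub : has_sup (range t).
    split; first by exists (t 0%N), 0%N.
    by exists (t 0%N + z_ 0%N) => _ [n _ <-].
  exists (sup (range t)) => n; apply/andP; split.
    by apply: ub_le_sup; [case: ub|exists n].
  by apply: ge_sup; [case: ub|move=> _ [k _ <-]].
have [sx [p pP]] := nested (fun n => (s n).1) w_ w_0 (halfE w)
   (fun n => let: And3 _ e _ := gP (n, s n) (sP n) in e).
have [sy [q qP]] := nested (fun n => (s n).2) h_ h_0 (halfE h)
   (fun n => let: And3 _ _ e := gP (n, s n) (sP n) in e).
have wE : w_ 0%N = w by rewrite /w_ expr0 divr1.
have hE : h_ 0%N = h by rewrite /h_ expr0 divr1.
have pP0 := pP 0%N; have qP0 := qP 0%N.
rewrite /= wE in pP0; rewrite /= hE in qP0.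
have [d d0 dP] := loc p q pP0 qP0.
have small (z : R) : 0 <= z -> \forall n \near \oo, z / 2 ^+ n < d.
  move=> z0.
  have : (fun n => z * (2^-1) ^+ n) @ \oo --> z * 0.
    apply: cvgMr; apply: cvg_expr; rewrite ger0_norm; lra.
  rewrite mulr0 => /cvgrPdist_lt /(_ d d0); apply: filterS => n.
  rewrite sub0r normrN exprVn; apply: le_lt_trans; exact: ler_norm.
near \oo => n; apply: (sP n); apply: dP => //.
- by have [] := sx n.
- by have [_] := sx n; rewrite /= wE.
- by have [] := sy n.
- by have [_] := sy n; rewrite /= hE.
- by near: n; exact: small.
- by near: n; exact: small.
Unshelve. all: by end_near. Qed.

(** The mean value theorem for [F - G - k z]. It compares two opposite sides of a rectangle at
    once. *)
Lemma increment_le (f g F G : R -> R) (a b k C : R) : a <= b ->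
  (forall z, a <= z <= b -> is_derive z 1 F (f z)) ->
  (forall z, a <= z <= b -> is_derive z 1 G (g z)) ->
  (forall z, a <= z <= b -> `|f z - g z - k| <= C) ->
  `|F b - G b - (F a - G a) - k * (b - a)| <= C * (b - a).
Proof.
move=> ab dF dG fgk.
have dH z : a <= z <= b ->
    is_derive z 1 (fun z => F z - G z - k * z) (f z - g z - k * 1).
  by move=> zz; have := dF z zz; have := dG z zz => ? ?; apply: is_deriveB.
have := @MVT_segment R (fun z => F z - G z - k * z)
    (fun z => f z - g z - k * 1) a b ab.
case.
- by move=> z /[!in_itv]/= /andP[az zb]; apply: dH; rewrite !ltW.
- apply: derivable_within_continuous => z /[!in_itv]/= zz.
  by have [] := dH z zz.
- move=> z /[!in_itv]/= zz Ez.
  rewrite (_ : _ - _ - _ = (f z - g z - k) * (b - a)).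
    rewrite normrM (ger0_norm (x := b - a)) ?subr_ge0//.
    by rewrite ler_wpM2r ?fgk ?subr_ge0.
  by move: Ez; rewrite mulr1 => <-; ring.
Qed.

(** The same [l] is the slope of [u] in [x] and of [v] in [y], so the affine parts of the field
    contribute [l (b - a) (d - c)] twice with opposite signs. Only the errors, at most [B] on each
    side, survive. *)
Lemma circulation_le (u v U V : R -> R -> R) (a b c d p q l m n B : R) :
  a <= b -> c <= d ->
  (forall x y, a <= x <= b -> c <= y <= d -> is_derive y 1 (U x) (u x y)) ->
  (forall x y, a <= x <= b -> c <= y <= d -> is_derive x 1 (V y) (v x y)) ->
  (forall x y, a <= x <= b -> c <= y <= d ->
     `|u x y - u p q - l * (x - p) - m * (y - q)| <= B /\
     `|v x y - v p q - n * (x - p) - l * (y - q)| <= B) ->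
  `|U b d - U b c - (U a d - U a c) - (V d b - V d a - (V c b - V c a))|
    <= 2 * B * (b - a + (d - c)).
Proof.
move=> ab cd dU dV H.
have aab : a <= a <= b by rewrite lexx ab.
have bab : a <= b <= b by rewrite lexx ab.
have ccd : c <= c <= d by rewrite lexx cd.
have dcd : c <= d <= d by rewrite lexx cd.
have IU : `|U b d - U a d - (U b c - U a c) - l * (b - a) * (d - c)|
    <= 2 * B * (d - c).
  apply: (increment_le cd (fun y => dU b y bab) (fun y => dU a y aab)) => y ycd.
  have [H1 _] := H b y bab ycd; have [H2 _] := H a y aab ycd.
  rewrite (_ : _ - _ - _ = (u b y - u p q - l * (b - p) - m * (y - q))
    - (u a y - u p q - l * (a - p) - m * (y - q))); last ring.
  apply: le_trans (ler_normB _ _) _.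
  by rewrite mulr_natl mulr2n lerD.
have IV : `|V d b - V c b - (V d a - V c a) - l * (d - c) * (b - a)|
    <= 2 * B * (b - a).
  apply: (increment_le ab (fun x xab => dV x d xab dcd)
    (fun x xab => dV x c xab ccd)) => x xab.
  have [_ H1] := H x d xab dcd; have [_ H2] := H x c xab ccd.
  rewrite (_ : _ - _ - _ = (v x d - v p q - n * (x - p) - l * (d - q))
    - (v x c - v p q - n * (x - p) - l * (c - q))); last ring.
  apply: le_trans (ler_normB _ _) _.
  by rewrite mulr_natl mulr2n lerD.
rewrite (_ : _ - _ - _ =
   (U b d - U a d - (U b c - U a c) - l * (b - a) * (d - c)) -
   (V d b - V c b - (V d a - V c a) - l * (d - c) * (b - a))); last ring.
apply: le_trans (ler_normB _ _) _.
by rewrite [leRHS]mulrDr [leRHS]addrC; apply: lerD.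
Qed.

(* [V] and [U] are primitives of [v] in [x] and of [u] in [y], so the
   conclusion says that the circulation of [v dx + u dy] vanishes. *)
Lemma goursat_rectangle (u v U V : R -> R -> R) (a b c d : R) :
  a <= b -> c <= d ->
  (forall x y, a <= x <= b -> c <= y <= d ->
     is_derive y 1 (U x) (u x y)) ->
  (forall x y, a <= x <= b -> c <= y <= d ->
     is_derive x 1 (V y) (v x y)) ->
  (forall x y, a <= x <= b -> c <= y <= d -> exists l m n, forall e : R, 0 < e ->
     exists2 r : R, 0 < r & forall x' y', a <= x' <= b -> c <= y' <= d ->
       `|x' - x| < r -> `|y' - y| < r ->
       `|u x' y' - u x y - l * (x' - x) - m * (y' - y)|
          <= e * (`|x' - x| + `|y' - y|) /\
       `|v x' y' - v x y - n * (x' - x) - l * (y' - y)|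
          <= e * (`|x' - x| + `|y' - y|)) ->
  U b d - U b c - (U a d - U a c) = V d b - V d a - (V c b - V c a).
Proof.
move=> ab cd dU dV loc.
pose Phi x x' y y' := U x' y' - U x' y - (U x y' - U x y)
                      - (V y' x' - V y' x - (V y x' - V y x)).
suff small (e : R) : 0 < e -> `|Phi a b c d| <= e * (4 * (b - a + (d - c)) ^+ 2).
  apply/eqP; rewrite -subr_eq0 -[X in X == 0]/(Phi a b c d) -normr_eq0 eq_le.
  rewrite normr_ge0 andbT; apply/ler_addgt0Pr => e e0; rewrite add0r.
  pose K := 4 * (b - a + (d - c)) ^+ 2 : R.
  have K0 : 0 <= K by rewrite mulr_ge0// sqr_ge0.
  have /small /le_trans : 0 < e / (K + 1) by rewrite divr_gt0//; lra.
  apply; rewrite -/K -mulrA ler_piMr ?(ltW e0)// [_^-1 * _]mulrC.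
  by rewrite ler_pdivrMr; lra.
move=> e0; pose w := b - a; pose h := d - c.
have w0 : 0 <= w by rewrite /w; lra.
have h0 : 0 <= h by rewrite /h; lra.
(* The allowance is divided by 4 at each stage, hence shared exactly among the four quarters, whose
   circulations add up. *)
have := @rectangle_bisection (fun x y n =>
  `|Phi x (x + w / 2 ^+ n) y (y + h / 2 ^+ n)|
     <= e * (4 * (w + h) ^+ 2) / 4 ^+ n) a c w h w0 h0.
rewrite /= !expr0 !divr1 /w /h !subrKC; apply; rewrite -/w -/h.
  move=> x y n.
  set k := e * _.
  have -> : k / 4 ^+ n = k / 4 ^+ n.+1 + k / 4 ^+ n.+1 + (k / 4 ^+ n.+1 + k / 4 ^+ n.+1).
    by rewrite exprS; field; rewrite expf_neq0.
  have halfE (z : R) : z / 2 ^+ n = z / 2 ^+ n.+1 + z / 2 ^+ n.+1.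
    by rewrite exprS; field; rewrite expf_neq0.
  rewrite !halfE !addrA.
  set p := w / _; set q := h / _; set z := k / _ => H1 H2 H3 H4.
  rewrite (_ : Phi x (x + p + p) y (y + q + q) =
     Phi x (x + p) y (y + q) + Phi (x + p) (x + p + p) y (y + q) +
     Phi x (x + p) (y + q) (y + q + q) +
     Phi (x + p) (x + p + p) (y + q) (y + q + q)); last by rewrite /Phi; ring.
  by do 3 apply: le_trans (ler_normD _ _) (lerD _ _) => //.
move=> p q pab qcd.
have [||l [m [n /(_ e e0)[r r0 H]]]] := loc p q.
- by rewrite /w in pab; lra.
- by rewrite /h in qcd; lra.
exists r => // x y k ax xb cy yd xp yq wr hr.
have w_0 : 0 <= w / 2 ^+ k by rewrite divr_ge0// exprn_ge0.
have h_0 : 0 <= h / 2 ^+ k by rewrite divr_ge0// exprn_ge0.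
have -> : e * (4 * (w + h) ^+ 2) / 4 ^+ k = e * (4 * (w / 2 ^+ k + h / 2 ^+ k) ^+ 2).
  have -> : (4 : R) ^+ k = (2 ^+ k) ^+ 2 by rewrite -exprM mulnC exprM; congr (_ ^+ _); lra.
  by field; rewrite expf_neq0.
move: w_0 h_0 xb yd xp yq wr hr; set w' := w / _; set h' := h / _.
move=> w_0 h_0 xb yd /andP[xp xp'] /andP[yq yq'] wr hr.
have xb' : x + w' <= b by rewrite /w in xb; lra.
have yd' : y + h' <= d by rewrite /h in yd; lra.
have xw : x <= x + w' by rewrite lerDl.
have yh : y <= y + h' by rewrite lerDl.
have sub_x s : x <= s <= x + w' -> a <= s <= b.
  by move=> /andP[? ?]; rewrite (le_trans ax)// (le_trans _ xb').
have sub_y t : y <= t <= y + h' -> c <= t <= d.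
  by move=> /andP[? ?]; rewrite (le_trans cy)// (le_trans _ yd').
have near (z0 z z1 k' : R) : z0 <= z <= z0 + k' -> z0 <= z1 <= z0 + k' -> `|z1 - z| <= k'.
  by rewrite ler_norml => /andP[? ?] /andP[? ?]; apply/andP; split; lra.
have wh : x + w' - x + (y + h' - y) = w' + h' by ring.
(* The factor 4 is the 2 of [circulation_le] times a 2 of slack in the error bound. *)
have -> : e * (4 * (w' + h') ^+ 2)
    = 2 * (2 * (e * (w' + h'))) * (x + w' - x + (y + h' - y)) by rewrite wh; ring.
apply: (@circulation_le u v U V x (x + w') y (y + h') p q l m n) => //.
- by move=> s t /sub_x sx /sub_y ty; exact: dU.
- by move=> s t /sub_x sx /sub_y ty; exact: dV.
move=> s t sx ty.
have ps : `|s - p| <= w' by apply: near sx; rewrite xp.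
have qt : `|t - q| <= h' by apply: near ty; rewrite yq.
have [] := H s t (sub_x s sx) (sub_y t ty) (le_lt_trans ps wr) (le_lt_trans qt hr).
have E : e * (`|s - p| + `|t - q|) <= 2 * (e * (w' + h')).
  rewrite mulr_natl mulr2n ler_wpDr ?mulr_ge0 ?addr_ge0 ?(ltW e0)//.
  by rewrite ler_pM2l// lerD.
by move=> A B; split; [apply: le_trans A E|apply: le_trans B E].
Qed.

End Goursat.

(** * Complex derivatives and the Schwarz lemma on the disc *)

Section ComplexDerivative.
Variable R : realType.
Local Notation C := R[i].
Local Notation nrm := (@Normc.normc R).
Local Notation Re := (@complex.Re R).
Local Notation Im := (@complex.Im R).
Implicit Types (z w d : C).

Lemma nrmE z : `|z| = (nrm z)%:C%C.
Proof. by []. Qed.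

Lemma nrm_sqr z : nrm z ^+ 2 = Re z ^+ 2 + Im z ^+ 2.
Proof. by case: z => a b /=; rewrite sqr_sqrtr// addr_ge0 ?sqr_ge0. Qed.

Lemma nrm_ge0 z : 0 <= nrm z.
Proof. by case: z => a b /=; rewrite sqrtr_ge0. Qed.

Lemma nrmD z w : nrm (z + w) <= nrm z + nrm w.
Proof. exact: le_normcD. Qed.

Lemma nrmN z : nrm (- z) = nrm z.
Proof. exact: normcN. Qed.

Lemma nrmB z w : nrm (z - w) <= nrm z + nrm w.
Proof. by rewrite -(nrmN w) nrmD. Qed.

Lemma nrm_real (x : R) : nrm x%:C%C = `|x|.
Proof. by rewrite /= expr0n addr0 sqrtr_sqr. Qed.

Lemma nrm_eq0 z : (nrm z == 0) = (z == 0).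
Proof.
by apply/eqP/eqP => [/Normc.eq0_normc//|->]; rewrite Normc.normc0.
Qed.

Lemma nrm_gt0 z : (0 < nrm z) = (z != 0).
Proof. by rewrite lt0r nrm_ge0 nrm_eq0 andbT. Qed.

Lemma nrm_conj z : nrm z^*%C = nrm z.
Proof. by case: z => a b /=; rewrite sqrrN. Qed.

Lemma normr_Re_le z : `|Re z| <= nrm z.
Proof. by have := normc_ge_Re z; rewrite nrmE lecR. Qed.

Lemma normr_Im_le z : `|Im z| <= nrm z.
Proof.
by case: z => a b /=; rewrite -(sqrtr_sqr b) ler_wsqrtr// lerDr sqr_ge0.
Qed.

Lemma Re_le_nrm z : Re z <= nrm z.
Proof. exact: le_trans (ler_norm _) (normr_Re_le z). Qed.

Lemma nrm_le_Re_Im z : nrm z <= `|Re z| + `|Im z|.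
Proof.
rewrite {1}(complexE z); apply: le_trans (nrmD _ _) _.
rewrite Normc.normcM !nrm_real (_ : nrm 'i%C = 1) ?mul1r//.
by rewrite /= expr0n expr1n add0r sqrtr1.
Qed.

Lemma Re_add z w : Re (z + w) = Re z + Re w. Proof. by case: z w => ? ? []. Qed.
Lemma Re_opp z : Re (- z) = - Re z. Proof. by case: z. Qed.
Lemma Im_add z w : Im (z + w) = Im z + Im w. Proof. by case: z w => ? ? []. Qed.
Lemma Im_opp z : Im (- z) = - Im z. Proof. by case: z. Qed.
Lemma Re_mul z w : Re (z * w) = Re z * Re w - Im z * Im w.
Proof. by case: z w => ? ? []. Qed.
Lemma Im_mul z w : Im (z * w) = Re z * Im w + Im z * Re w.
Proof. by case: z w => ? ? []. Qed.

(** Tolerances and moduli are real here, so that error estimates are inequalities in the ordered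
    field [R]. *)
Definition cderiv (h : C -> C) z d := forall e : R, 0 < e ->
  exists2 r : R, 0 < r & forall w, nrm (w - z) < r ->
    nrm (h w - h z - d * (w - z)) <= e * nrm (w - z).

Lemma cderiv_lipschitz h z d : cderiv h z d ->
  exists2 r : R, 0 < r & forall w, nrm (w - z) < r ->
    nrm (h w - h z) <= (1 + nrm d) * nrm (w - z).
Proof.
move=> /(_ 1 ltr01)[r r0 H]; exists r => // w /H; rewrite mul1r => H1.
rewrite -(subrK (d * (w - z)) (h w - h z)); apply: le_trans (nrmD _ _) _.
by rewrite Normc.normcM mulrDl mul1r lerD2r.
Qed.

Lemma cderiv_continuous h z d : cderiv h z d -> forall e : R, 0 < e ->
  exists2 r : R, 0 < r & forall w, nrm (w - z) < r -> nrm (h w - h z) < e.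
Proof.
move=> /cderiv_lipschitz[r r0 H] e e0.
have K0 : 0 < 1 + nrm d by have := nrm_ge0 d; lra.
exists (Num.min r (e / (1 + nrm d))); first by rewrite lt_min r0 divr_gt0.
move=> w; rewrite lt_min => /andP[/H H1]; rewrite ltr_pdivlMr// mulrC.
exact: le_lt_trans.
Qed.

Lemma cderiv_eq_near h g z d (r : R) : 0 < r ->
  (forall w, nrm (w - z) < r -> h w = g w) -> cderiv h z d -> cderiv g z d.
Proof.
move=> r0 hg dh e /dh[s s0 H]; exists (Num.min r s); first by rewrite lt_min r0.
move=> w; rewrite lt_min => /andP[wr /H]; rewrite !hg//.
by rewrite subrr Normc.normc0.
Qed.

Lemma cderiv_comp g h z dg dh : cderiv h z dh -> cderiv g (h z) dg ->
  cderiv (g \o h) z (dg * dh).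
Proof.
move=> hd gd e e0.
have [r1 r10 lip] := cderiv_lipschitz hd.
set K := 1 + nrm dh in lip.
have K0 : 0 < K by rewrite /K; have := nrm_ge0 dh; lra.
have L0 : 0 < 1 + nrm dg by have := nrm_ge0 dg; lra.
have [|r2 r20 H2] := hd (e / 2 / (1 + nrm dg)); first by rewrite !divr_gt0.
have [|r3 r30 H3] := gd (e / 2 / K); first by rewrite !divr_gt0.
exists (Num.min r1 (Num.min r2 (r3 / K))).
  by rewrite !lt_min r10 r20 divr_gt0.
move=> w; rewrite !lt_min => /and3P[/lip w1 /H2 w2].
rewrite ltr_pdivlMr// mulrC => /(le_lt_trans w1)/H3 w3 /=.
rewrite (_ : _ - _ = (g (h w) - g (h z) - dg * (h w - h z)) +
   dg * (h w - h z - dh * (w - z))); last ring.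
apply: le_trans (nrmD _ _) _; rewrite Normc.normcM.
rewrite [e]splitr mulrDl lerD//.
  apply: le_trans w3 _; rewrite -mulrA; rewrite ler_pM2l ?divr_gt0//.
  by rewrite mulrC ler_pdivrMr// mulrC.
apply: le_trans (ler_wpM2l (nrm_ge0 _) w2) _.
by rewrite mulrA ler_wpM2r ?nrm_ge0// mulrA ler_pdivrMr// mulrC ler_wpM2l; lra.
Qed.

Lemma cderivV z : z != 0 -> cderiv (fun w => w^-1) z (- z^-1 ^+ 2).
Proof.
move=> z0 e e0; have nz0 : 0 < nrm z by rewrite nrm_gt0.
(* The first radius keeps [nrm w] above [nrm z / 2]; the second then bounds the remainder
   [(w - z)^2 / (w z^2)]. *)
exists (Num.min (nrm z / 2) (e * nrm z ^+ 3 / 2)).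
  by rewrite lt_min !divr_gt0// mulr_gt0// exprn_gt0.
move=> w; rewrite lt_min => /andP[w1 w2].
have nw : nrm z / 2 < nrm w.
  have := nrmB w (w - z); rewrite opprB subrKC; lra.
have w0 : w != 0 by rewrite -nrm_gt0; lra.
rewrite (_ : _ - _ - _ = (w - z) * ((w - z) * (w * (z * z))^-1)); last first.
  by field; rewrite z0.
rewrite !Normc.normcM mulrC ler_wpM2r ?nrm_ge0// Normc.normcV.
rewrite !Normc.normcM ler_pdivrMr ?mulr_gt0 ?(lt_trans _ nw) ?divr_gt0//.
apply: le_trans (ltW w2) _; rewrite -mulrA ler_pM2l//.
have -> : nrm z ^+ 3 / 2 = (nrm z / 2) * (nrm z * nrm z) by field.
by rewrite ler_wpM2r ?mulr_ge0 ?nrm_ge0// ltW.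
Qed.

Lemma cderivM g h z dg dh : cderiv g z dg -> cderiv h z dh ->
  cderiv (fun w => g w * h w) z (dg * h z + g z * dh).
Proof.
move=> gd hd e e0.
have [r1 r10 lip] := cderiv_lipschitz gd.
set K := 1 + nrm dg in lip.
have K0 : 0 < K by rewrite /K; have := nrm_ge0 dg; lra.
have L0 : 0 < 1 + nrm (h z) by have := nrm_ge0 (h z); lra.
have M0 : 0 < 1 + nrm (g z) by have := nrm_ge0 (g z); lra.
have [|r2 r20 H2] := hd (e / 3 / (1 + nrm (g z))); first by rewrite !divr_gt0.
have [|r3 r30 H3] := gd (e / 3 / (1 + nrm (h z))); first by rewrite !divr_gt0.
have [|r4 r40 H4] := cderiv_continuous hd (e := e / 3 / K).
  by rewrite !divr_gt0.
exists (Num.min (Num.min r1 r4) (Num.min r2 r3)).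
  by rewrite !lt_min r10 r20 r30 r40.
move=> w; rewrite !lt_min => /andP[/andP[/lip w1 /H4 w4] /andP[/H2 w2 /H3 w3]].
rewrite (_ : _ - _ - _ = (g w - g z - dg * (w - z)) * h z +
   g z * (h w - h z - dh * (w - z)) + (g w - g z) * (h w - h z)); last ring.
apply: le_trans (nrmD _ _) _; rewrite Normc.normcM.
apply: le_trans (lerD (nrmD _ _) (lexx _)) _; rewrite !Normc.normcM.
have -> : e * nrm (w - z) =
    e / 3 * nrm (w - z) + e / 3 * nrm (w - z) + e / 3 * nrm (w - z) by lra.
have nwz := nrm_ge0 (w - z).
apply: lerD; first apply: lerD.
- apply: le_trans (ler_wpM2r (nrm_ge0 _) w3) _.
  by rewrite mulrAC ler_wpM2r// mulrAC ler_pdivrMr// ler_wpM2l//; lra.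
- apply: le_trans (ler_wpM2l (nrm_ge0 _) w2) _.
  rewrite mulrA ler_wpM2r// mulrA ler_pdivrMr// mulrC ler_wpM2l//; lra.
- apply: le_trans (ler_pM (nrm_ge0 _) (nrm_ge0 _) w1 (ltW w4)) _.
  by rewrite mulrAC mulrCA mulfV ?gt_eqF// mulr1.
Qed.

End ComplexDerivative.

(** * The complex exponential and the derivative bound at the center of the disc *)

Section SchwarzDerivative.
Variable R : realType.
Local Open Scope classical_set_scope.
Local Open Scope ring_scope.
Local Notation C := R[i].
Local Notation nrm := (@Normc.normc R).
Local Notation Re := (@complex.Re R).
Local Notation Im := (@complex.Im R).

Lemma is_derive_dist (f : R -> R) (x l : R) : is_derive x 1 f l ->
  forall e : R, 0 < e -> exists2 r : R, 0 < r & forall y, `|y - x| < r ->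
    `|f y - f x - l * (y - x)| <= e * `|y - x|.
Proof.
move=> [dx fl] e e0; move: dx; rewrite /derivable -fl.
move=> /cvgrPdist_le /(_ e e0); rewrite -[lim _]/('D_1 f x) fl.
move=> /nbhs_ballP[r /= r0 H]; exists r => // y yx.
have [->|neq] := eqVneq y x; first by rewrite !subrr mulr0 subr0 normr0 mulr0.
have := H (y - x); rewrite /ball/= sub0r normrN => /(_ yx).
rewrite subr_eq0 => /(_ neq); rewrite /= scaler1 subrK.
have yx0 : y - x != 0 by rewrite subr_eq0.
rewrite distrC => H1.
have -> : f y - f x - l * (y - x) = ((y - x)^-1 *: (f y - f x) - l) * (y - x).
  by rewrite mulrBl -[_ *: _]/(_ * _) mulrAC mulVf// mul1r.
by rewrite normrM ler_wpM2r.
Qed.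

Definition cexp (w : C) : C :=
  (expR (Re w))%:C%C * (cos (Im w) +i* sin (Im w))%C.

Lemma nrm_polar (t : R) : nrm (cos t +i* sin t)%C = 1.
Proof. by rewrite /= cos2Dsin2 sqrtr1. Qed.

Lemma nrm_cexp w : nrm (cexp w) = expR (Re w).
Proof. by rewrite Normc.normcM nrm_polar mulr1 nrm_real ger0_norm ?expR_ge0. Qed.

Lemma cexp_neq0 w : cexp w != 0.
Proof. by rewrite -nrm_gt0 nrm_cexp expR_gt0. Qed.

Lemma cexpD z w : cexp (z + w) = cexp z * cexp w.
Proof.
rewrite /cexp Re_add Im_add expRD cosD sinD.
by apply/eqP; rewrite eq_complex /=; apply/andP; split; apply/eqP; ring.
Qed.

(** The addition formula reduces the estimate to the origin, where the first order expansions of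
    [expR], [cos] and [sin] combine. *)
Lemma cderiv_cexp z : cderiv cexp z (cexp z).
Proof.
(* Dividing by [expR (Re z)] offsets the factor [cexp z]; of the five shares, one goes to [expR],
   two to the mixed product and two to [cos] and [sin]. *)
move=> e e0; pose e' := e / expR (Re z) / 5.
have e'0 : 0 < e' by rewrite !divr_gt0// expR_gt0.
have [r1 r10 H1] := is_derive_dist (is_derive_expR (0 : R)) e'0.
have [r2 r20 H2] := is_derive_dist (is_derive_cos (0 : R)) e'0.
have [r3 r30 H3] := is_derive_dist (is_derive_sin (0 : R)) e'0.
have [r4 r40 H4] := is_derive_dist (is_derive_cos (0 : R)) ltr01.
have [r5 r50 H5] := is_derive_dist (is_derive_sin (0 : R)) ltr01.
exists (Num.min (Num.min r1 r2) (Num.min (Num.min r3 (e' / 3)) (Num.min r4 r5))).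
  by rewrite !lt_min r10 r20 r30 r40 r50 divr_gt0.
move=> w; rewrite !lt_min.
move=> /andP[/andP[wr1 wr2] /andP[/andP[wr3 we] /andP[wr4 wr5]]].
set v := w - z in wr1 wr2 wr3 we wr4 wr5 *.
have -> : w = z + v by rewrite /v; ring.
rewrite cexpD (_ : _ - _ - _ = cexp z * (cexp v - 1 - v)); last ring.
rewrite Normc.normcM nrm_cexp mulrC -ler_pdivlMr ?expR_gt0//.
rewrite mulrAC (_ : e / _ = e' * 5); last by rewrite /e' divfK.
have vRe := normr_Re_le v; have vIm := normr_Im_le v.
case: v vRe vIm wr1 wr2 wr3 we wr4 wr5 => a b; set N : R := nrm _.
rewrite [complex.Re _]/= [complex.Im _]/= => aN bN wr1 wr2 wr3 we wr4 wr5.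
have := H1 a; have := H2 b; have := H3 b; have := H4 b; have := H5 b.
rewrite !subr0 !(le_lt_trans aN) ?(le_lt_trans bN)// expR0 cos0 sin0 oppr0.
rewrite !mul0r !subr0 !mul1r !addr0 => /(_ isT) h5 /(_ isT) h4 /(_ isT) h3 /(_ isT) h2 /(_ isT) h1.
rewrite (_ : cexp _ - 1 - _ = (expR a - 1 - a)%:C%C * (cos b +i* sin b)%C
   + a%:C%C * ((cos b - 1) +i* sin b)%C + ((cos b - 1) +i* (sin b - b))%C); last first.
  by apply/eqP; rewrite eq_complex /=; apply/andP; split; apply/eqP; ring.
have N0 : 0 <= N by exact: nrm_ge0.
have -> : e' * 5 * N = e' * N + (2 * (e' * N)) + (2 * (e' * N)) by ring.
have e'a : e' * `|a| <= e' * N by rewrite ler_pM2l.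
have e'b : e' * `|b| <= e' * N by rewrite ler_pM2l.
apply: le_trans (nrmD _ _) _; apply: lerD; last first.
  by apply: le_trans (nrm_le_Re_Im _) _ => /=; lra.
apply: le_trans (nrmD _ _) _; rewrite !Normc.normcM nrm_polar mulr1 !nrm_real.
apply: lerD; first lra.
have sb : `|sin b| <= 2 * `|b|.
  by rewrite -(subrK b (sin b)); apply: le_trans (ler_normD _ _) _; lra.
have nb : nrm ((cos b - 1) +i* sin b)%C <= 3 * N.
  by apply: le_trans (nrm_le_Re_Im _) _ => /=; lra.
apply: le_trans (ler_pM _ _ aN nb) _ => //; first exact: nrm_ge0.
have : N * N <= e' / 3 * N by rewrite ler_wpM2r// ltW.
have : 0 <= e' * N by rewrite mulr_ge0// ltW.
lra.
Qed.

(* Cauchy's theorem for [g (exp w)] on [[s0, s1] x [0, 2 pi]], whose horizontal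
   sides cancel by periodicity, shows that the circular means of [g z = h z / z]
   do not depend on the radius. *)
Lemma schwarz_derivative (h : C -> C) (d : C) :
  (forall z, nrm z < 1 -> exists d, cderiv h z d) ->
  (forall z, nrm z < 1 -> nrm (h z) <= 1) ->
  h 0 = 0 -> cderiv h 0 d -> Re d <= 1.
Proof.
move=> dh h1 h00 hd.
pose k w := (cexp w)^-1 * h (cexp w).
have dk w : Re w < 0 -> exists D, cderiv k w D.
  move=> w0; have w1 : nrm (cexp w) < 1 by rewrite nrm_cexp -expR0 ltr_expR.
  have [d' hd'] := dh _ w1.
  exists ((- (cexp w)^-1 ^+ 2 * h (cexp w) + (cexp w)^-1 * d') * cexp w).
  exact: cderiv_comp (cderiv_cexp w) (cderivM (cderivV (cexp_neq0 w)) hd').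
pose u s t := Re (k (s +i* t)%C); pose v s t := Im (k (s +i* t)%C).
have cu s t : s < 0 -> {for t, continuous (u s)}.
  move=> s0; have [D kD] := dk (s +i* t)%C s0.
  apply/cvgrPdist_lt => e e0; have [r r0 H] := cderiv_continuous kD e0.
  apply/nbhs_ballP; exists r => // t' /= tt'.
  rewrite /u -Re_opp -Re_add; apply: le_lt_trans (normr_Re_le _) _.
  rewrite -nrmN opprB; apply: H.
  by rewrite /= subrr expr0n add0r sqrtr_sqr distrC.
have cv s t : s < 0 -> {for s, continuous (v ^~ t)}.
  move=> s0; have [D kD] := dk (s +i* t)%C s0.
  apply/cvgrPdist_lt => e e0; have [r r0 H] := cderiv_continuous kD e0.
  apply/nbhs_ballP; exists r => // s' /= ss'.
  rewrite /v -Im_opp -Im_add; apply: le_lt_trans (normr_Im_le _) _.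
  rewrite -nrmN opprB; apply: H.
  by rewrite /= subrr expr0n addr0 sqrtr_sqr distrC.
have pi0 := pi_gt0 R.
(* Two circles are compared: on the outer one, of radius [expR s1], the quotient is at most
   [expR (- s1)]; on the inner one, of radius [expR s0 < r], it is within [e] of [d]. *)
have mean_le s1 e : s1 < 0 -> 0 < e -> Re d - e <= expR (- s1).
  move=> s10 e0; have [r r0 H] := hd e e0.
  pose s0 := Num.min (s1 - 1) (ln (Num.min (r / 2) (1 / 2))).
  have s01 : s0 < s1 by rewrite /s0 gt_min; apply/orP; left; lra.
  have r'0 : 0 < Num.min (r / 2) (1 / 2) by rewrite lt_min !divr_gt0.
  have rs0 : expR s0 < r.
    apply: (@le_lt_trans _ _ (r / 2)); last by lra.
    apply: (@le_trans _ _ (Num.min (r / 2) (1 / 2))); last by rewrite ge_min lexx.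
    by rewrite -[leRHS]lnK// ler_expR /s0 ge_min lexx orbT.
  have /choice[U dU] : forall s, exists U : R -> R, s < 0 ->
      forall t, 0 <= t <= 2 * pi -> is_derive t 1 U (u s t).
    move=> s; have [s_0|s_0] := ltP s 0; last by exists id.
    have [||U HU] := @primitive_exists R (u s) (-1) (2 * pi + 1); first lra.
      by move=> t _; apply: cu.
    by exists U => _ t t2; apply: HU; lra.
  (* The primitive is chosen as a function of [f], not of the height [t]: the equal functions at
     heights 0 and [2 pi] then receive the same primitive, and the horizontal sides cancel. *)
  have /choice[Pr dPr] : forall f : R -> R, exists F : R -> R,
      (forall s, s < 0 -> {for s, continuous f}) ->
      forall s, s0 <= s <= s1 -> is_derive s 1 F (f s).
    move=> f; have [cf|] := pselect (forall s, s < 0 -> {for s, continuous f}).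
      have [||F HF] := @primitive_exists R f (s0 - 1) (s1 / 2); first lra.
        by move=> x xx; apply: cf; lra.
      by exists F => _ s ss; apply: HF; lra.
    by exists id.
  have dV s t : s0 <= s <= s1 -> is_derive s 1 (Pr (v ^~ t)) (v s t).
    by move=> ss; exact: (dPr _ (fun x x0 => cv x t x0) s ss).
  have := @goursat_rectangle R u v U (fun t => Pr (v ^~ t)) s0 s1 0 (2 * pi).
  have -> : v ^~ (2 * pi) = v ^~ 0.
    apply/funext => s; rewrite /v /k /cexp/=.
    by rewrite [2 * pi]mulr_natl sin2pi cos2pi sin0 cos0.
  rewrite subrr => G.
  have {}G : U s1 (2 * pi) - U s1 0 - (U s0 (2 * pi) - U s0 0) = 0.
    apply: G; [lra|lra| | |].
    - by move=> s t ss tt; apply: dU => //; lra.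
    - by move=> s t ss _; apply: dV.
    - move=> s t ss tt; have [|D kD] := dk (s +i* t)%C; first by rewrite /=; lra.
      (* These are the Cauchy-Riemann equations: multiplication by [D] has the slope [Re D] both for
         [u] in [s] and for [v] in [t]. *)
      exists (Re D), (- Im D), (Im D) => e' e'0.
      have [r' r'_0 Hr'] := kD e' e'0.
      exists (r' / 2); first by rewrite divr_gt0.
      move=> s' t' _ _ s'r t'r.
      have st : nrm ((s' +i* t')%C - (s +i* t)%C) <= `|s' - s| + `|t' - t|.
        by apply: le_trans (nrm_le_Re_Im _) _.
      have /Hr' Hst : nrm ((s' +i* t')%C - (s +i* t)%C) < r'.
        by apply: le_lt_trans st _; lra.
      have {}Hst := le_trans Hst (ler_wpM2l (ltW e'0) st).
      split.
        apply: le_trans Hst; apply: le_trans (normr_Re_le _).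
        rewrite 2!Re_add !Re_opp Re_mul /= /u le_eqVlt; apply/orP; left.
        by apply/eqP; congr `| _ |; ring.
      apply: le_trans Hst; apply: le_trans (normr_Im_le _).
      rewrite 2!Im_add !Im_opp Im_mul /= /v le_eqVlt; apply/orP; left.
      by apply/eqP; congr `| _ |; ring.
  (* Each circular mean is replaced by a value attained on the circle. *)
  have MVT_U s : s < 0 -> exists2 t, True &
      U s (2 * pi) - U s 0 = u s t * (2 * pi).
    move=> s_0; have [|||t _ ->] := @MVT_segment R (U s) (u s) 0 (2 * pi).
    - lra.
    - move=> t /[!in_itv]/= tt; apply: dU => //; lra.
    - apply: derivable_within_continuous => t /[!in_itv]/= tt.
      by have [] := dU s s_0 t tt.
    - by exists t; rewrite ?subr0.
  have [t1 _ E1] := MVT_U s1 s10; have [t0 _ E0] := MVT_U s0 (lt_trans s01 s10).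
  have uu : u s1 t1 = u s0 t0.
    move/eqP: G; rewrite E1 E0 -mulrBl mulf_eq0 subr_eq0 => /orP[/eqP//|].
    by rewrite mulf_eq0 pnatr_eq0/= gt_eqF.
  apply: (@le_trans _ _ (u s0 t0)); last first.
    rewrite -uu /u; apply: le_trans (Re_le_nrm _) _.
    rewrite /k Normc.normcM Normc.normcV nrm_cexp/= expRN ler_piMr ?invr_ge0 ?expR_ge0//.
    by apply: h1; rewrite nrm_cexp/= -expR0 ltr_expR.
  rewrite /u /k; set w := cexp _.
  have w0 : w != 0 by exact: cexp_neq0.
  have := H w; rewrite subr0 nrm_cexp/= => /(_ rs0); rewrite h00 subr0 => Hw.
  have : nrm (d - w^-1 * h w) <= e.
    rewrite -nrmN opprB (_ : _ - _ = w^-1 * (h w - d * w)); last by field.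
    by rewrite Normc.normcM Normc.normcV mulrC ler_pdivrMr ?nrm_gt0// nrm_cexp.
  by move=> /(le_trans (Re_le_nrm _)); rewrite Re_add Re_opp; lra.
apply/ler_addgt0Pr => e e0.
have e2 : 0 < e / 2 by lra.
(* The outer radius tends to 1: this [s1] makes [expR (- s1)] equal to [1 + e / 2]. *)
have : - ln (1 + e / 2) < 0 by rewrite oppr_lt0 ln_gt0//; lra.
move=> /mean_le /(_ e2); rewrite opprK lnK ?posrE; lra.
Qed.

End SchwarzDerivative.

(** * Moebius maps of the disc, the Schwarz-Pick inequality and the Schwarz lemma *)

Section Schwarz.
Variable R : realType.
Local Open Scope classical_set_scope.
Local Open Scope ring_scope.
Local Notation C := R[i].
Local Notation nrm := (@Normc.normc R).
Local Notation Re := (@complex.Re R).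
Local Notation Im := (@complex.Im R).

Lemma cderiv_affine (b c z : C) : cderiv (fun w => b + c * w) z c.
Proof.
move=> e e0; exists 1 => // w _; rewrite (_ : _ - _ - _ = 0); last ring.
by rewrite Normc.normc0 mulr_ge0 ?nrm_ge0// ltW.
Qed.

Definition disc_mobius (a z : C) : C := (a - z) * (1 - a^*%C * z)^-1.

Lemma disc_mobius_den (a z : C) : nrm a < 1 -> nrm z < 1 -> 1 - a^*%C * z != 0.
Proof.
move=> a1 z1; rewrite subr_eq0; apply/eqP => /(congr1 nrm).
rewrite Normc.normc1 Normc.normcM nrm_conj => E.
suff : nrm a * nrm z < 1 by rewrite -E ltxx.
apply: le_lt_trans z1; rewrite ler_piMl ?nrm_ge0//; exact: ltW.
Qed.

(** The squared moduli of denominator and numerator differ by [(1 - |a|^2) (1 - |z|^2)], which is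
    positive. *)
Lemma disc_mobius_lt1 (a z : C) : nrm a < 1 -> nrm z < 1 ->
  nrm (disc_mobius a z) < 1.
Proof.
move=> a1 z1; have den := disc_mobius_den a1 z1.
rewrite Normc.normcM Normc.normcV ltr_pdivrMr ?nrm_gt0// mul1r.
rewrite -(@ltr_pXn2r _ 2) ?nnegrE ?nrm_ge0//.
have sq1 (w : C) : nrm w < 1 -> 0 < 1 - nrm w ^+ 2.
  by move=> w1; rewrite subr_gt0 expr_lt1 ?nrm_ge0.
rewrite -subr_gt0 (_ : _ - _ = (1 - nrm a ^+ 2) * (1 - nrm z ^+ 2)).
  by rewrite mulr_gt0 ?sq1.
by rewrite !nrm_sqr; case: a z {a1 z1 den} => [p q] [r s] /=; ring.
Qed.

Lemma cderiv_disc_mobius (a z : C) : nrm a < 1 -> nrm z < 1 ->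
  cderiv (disc_mobius a) z (- (1 - a^*%C * z)^-1 + (a - z) *
     (- (1 - a^*%C * z)^-1 ^+ 2 * - a^*%C)).
Proof.
move=> a1 z1; have den := disc_mobius_den a1 z1.
have d1 := cderiv_affine 1 (- a^*%C) z.
have dV : cderiv (fun w => w^-1) (1 + - a^*%C * z) (- (1 - a^*%C * z)^-1 ^+ 2).
  by rewrite mulNr; apply: cderivV.
have := cderivM (cderiv_affine a (-1) z) (cderiv_comp d1 dV).
rewrite /= !mulN1r mulNr; apply: cderiv_eq_near ltr01 _ => w _.
by rewrite /disc_mobius mulN1r mulNr.
Qed.

(** Moebius maps at [a] and at [b = h a] turn [h] into a self-map of the disc fixing 0, whose
    derivative there is [d (1 - |a|^2) / (1 - |b|^2)]. *)
Lemma schwarz_pick (h : C -> C) (a d : C) :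
  (forall z, nrm z < 1 -> exists d, cderiv h z d) ->
  (forall z, nrm z < 1 -> nrm (h z) < 1) -> nrm a < 1 -> cderiv h a d ->
  Re d * (1 - nrm a ^+ 2) <= 1 - nrm (h a) ^+ 2.
Proof.
move=> dh h1 a1 hd; have b1 := h1 _ a1; set b := h a in b1 *.
have sqE (w : C) : 1 - w^*%C * w = (1 - nrm w ^+ 2)%:C%C.
  by rewrite nrm_sqr; case: w => p q; apply/eqP; rewrite eq_complex /=;
    apply/andP; split; apply/eqP; ring.
have sq1 (w : C) : nrm w < 1 -> 0 < 1 - nrm w ^+ 2.
  by move=> w1; rewrite subr_gt0 expr_lt1 ?nrm_ge0.
have z1 : nrm (0 : C) < 1 by rewrite Normc.normc0.
have a0 : disc_mobius a 0 = a by rewrite /disc_mobius mulr0 !subr0 invr1 mulr1.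
pose F z := disc_mobius b (h (disc_mobius a z)).
have dF z d' : nrm z < 1 -> cderiv h (disc_mobius a z) d' ->
    exists d1 d2, [/\ cderiv F z (d2 * (d' * d1)),
      d1 = - (1 - a^*%C * z)^-1 + (a - z) * (- (1 - a^*%C * z)^-1 ^+ 2 * - a^*%C)
      & d2 = - (1 - b^*%C * h (disc_mobius a z))^-1 + (b - h (disc_mobius a z)) *
         (- (1 - b^*%C * h (disc_mobius a z))^-1 ^+ 2 * - b^*%C)].
  move=> zz hd'; eexists; eexists; split; last by reflexivity.
    apply: cderiv_comp (cderiv_comp (cderiv_disc_mobius a1 zz) hd') _.
    by apply: cderiv_disc_mobius => //; apply: h1; apply: disc_mobius_lt1.
  by [].
have [|d1 [d2 [dF0 d1E d2E]]] := dF 0 d z1; first by rewrite a0.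
have : Re (d2 * (d * d1)) <= 1.
  apply: schwarz_derivative dF0 => [z zz|z zz|].
  - have [d' hd'] := dh _ (disc_mobius_lt1 a1 zz).
    by have [e1 [e2 [dFz _ _]]] := dF z d' zz hd'; exists (e2 * (d' * e1)).
  - by apply/ltW/disc_mobius_lt1 => //; apply/h1/disc_mobius_lt1.
  - by rewrite /F a0 /disc_mobius subrr mul0r.
have -> : d2 * (d * d1) = ((1 - nrm a ^+ 2) / (1 - nrm b ^+ 2))%:C%C * d.
  rewrite d1E d2E a0 -/b subrr mul0r addr0 mulr0 subr0 invr1 expr1n sqE.
  rewrite rmorphM/= fmorphV/= -(sqE a); ring.
rewrite Re_mul/= mul0r subr0 mulrAC ler_pdivrMr ?sq1// mul1r mulrC.
by move=> ?.
Qed.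

Lemma cderiv_is_derive_Re (h : C -> C) (x : R) (d : C) : cderiv h x%:C%C d ->
  is_derive x 1 (fun t => Re (h t%:C%C)) (Re d).
Proof.
move=> hd.
have H : (fun t => t^-1 *: (Re (h (t + x)%:C%C) - Re (h x%:C%C))) @ 0^' --> Re d.
  apply/cvgrPdist_le => e e0; have [r r0 Hr] := hd e e0.
  apply/nbhs_ballP; exists r => //= t; rewrite /ball/= sub0r normrN => tr t0.
  have E : (t + x)%:C%C - x%:C%C = t%:C%C by rewrite rmorphD/= addrK.
  have := Hr (t + x)%:C%C; rewrite E nrm_real => /(_ tr) Ht.
  have := le_trans (normr_Re_le _) Ht.
  rewrite 2!Re_add 2!Re_opp Re_mul/= mulr0 subr0 => {}Ht.
  have -> : Re d - t^-1 *: (Re (h (t + x)%:C%C) - Re (h x%:C%C)) =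
     - (t^-1 * (Re (h (t + x)%:C%C) - Re (h x%:C%C) - Re d * t)).
    by rewrite -[_ *: _]/(_ * _); field.
  by rewrite normrN normrM normfV mulrC ler_pdivrMr ?normr_gt0.
apply: DeriveDef; last first.
  apply: cvg_lim => //; move: H; apply: cvg_trans; apply: near_eq_cvg.
  by near=> t; rewrite /= scaler1.
apply/cvg_ex; exists (Re d); move: H; apply: cvg_trans; apply: near_eq_cvg.
by near=> t; rewrite /= scaler1.
Unshelve. all: by end_near. Qed.

(* The Schwarz-Pick bound makes the hyperbolic difference
   [(t - k) / (1 - t k)] of [t] and [k t = Re (h t)] nondecreasing in [t]. *)
Lemma schwarz (h : C -> C) (x : R) :
  (forall z, nrm z < 1 -> exists d, cderiv h z d) ->
  (forall z, nrm z < 1 -> nrm (h z) < 1) -> h 0 = 0 -> 0 <= x < 1 ->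
  Re (h x%:C%C) <= x.
Proof.
move=> dh h1 h0 /andP[x0 x1].
pose k t := Re (h t%:C%C).
have nt (t : R) : 0 <= t <= x -> nrm t%:C%C < 1.
  by move=> tx; rewrite nrm_real ger0_norm; lra.
have k1 (t : R) : 0 <= t <= x -> -1 < k t < 1.
  by move=> /nt /h1 /(le_lt_trans (normr_Re_le _)); rewrite ltr_norml.
have den (t : R) : 0 <= t <= x -> 0 < 1 - t * k t by move=> tx; have := k1 t tx; nra.
have /choice[D dD] : forall t : R, exists d : C, 0 <= t <= x -> cderiv h t%:C%C d.
  move=> t; have [tx|] := pselect (0 <= t <= x); last by exists 0.
  by have [d] := dh _ (nt t tx); exists d.
pose M t := (t - k t) * (1 - t * k t)^-1.
pose M' t := (1 - k t ^+ 2 - Re (D t) * (1 - t ^+ 2)) / (1 - t * k t) ^+ 2.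
have dM t : 0 <= t <= x -> is_derive t 1 M (M' t).
  move=> tx; have dk : is_derive t 1 k (Re (D t)).
    by apply: cderiv_is_derive_Re; apply: dD.
  have t0 : 1 - t * k t != 0 by rewrite gt_eqF// den.
  have dden : is_derive t 1 (fun t => 1 - t * k t) (- (k t + t * Re (D t))).
    apply: is_derive_eq; rewrite -[_ *: _]/(_ * _) -[k t *: _]/(k t * 1); ring.
  have dV := @is_deriveV R (fun s => 1 - s * k s) t _ 1 t0 dden.
  have dB : is_derive t 1 (fun t => t - k t) (1 - Re (D t)) by apply: is_deriveB.
  apply: is_derive_eq.
  by rewrite /M' -![_ *: _]/(_ * _); field.
have M0 : M 0 = 0 by rewrite /M /k h0/= subr0 mul0r.
have [||c cx Mx] := @MVT_segment R M M' 0 x x0.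
- by move=> t /[!in_itv]/= tx; apply: dM; lra.
- apply: derivable_within_continuous => t /[!in_itv]/= tx.
  by have [] := dM t tx.
have {}cx : 0 <= c <= x by move: cx; rewrite in_itv.
have : 0 <= M x.
  move: Mx; rewrite M0 !subr0 => ->; rewrite mulr_ge0// divr_ge0 ?sqr_ge0//.
  (* Schwarz-Pick and [k c ^+ 2 <= nrm (h c) ^+ 2] make the numerator of [M' c] nonnegative. *)
  have := schwarz_pick dh h1 (nt c cx) (dD c cx).
  have : k c ^+ 2 <= nrm (h c%:C%C) ^+ 2.
    by rewrite nrm_sqr lerDl sqr_ge0.
  rewrite nrm_real real_normK ?num_real//; lra.
have xx : 0 <= x <= x by rewrite x0 lexx.
by rewrite /M pmulr_lge0 ?invr_gt0 ?den// subr_ge0.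
Qed.

End Schwarz.

(** * Moebius automorphisms of the ball *)

Section BallMobius.
Variables (R : realType) (m : nat).
Local Notation C := R[i].
Local Notation V := 'cV[C]_m.
Local Notation nrm := (@Normc.normc R).
Local Notation Re := (@complex.Re R).
Local Notation Im := (@complex.Im R).
Implicit Types (x y z w a c : V).

Lemma conj_real (t : R) : (t%:C%C)^* = t%:C%C :> C.
Proof. exact: conjc_real. Qed.

Lemma mulC_conj (t : C) : t * t^* = (nrm t ^+ 2)%:C%C.
Proof.
rewrite nrm_sqr -[t^*]/(t^*%C); case: t => p q; apply/eqP.
by rewrite eq_complex /=; apply/andP; split; apply/eqP; ring.
Qed.

Lemma innerDl x y z : inner (x + y) z = inner x z + inner y z.
Proof. by rewrite /inner -big_split; apply: eq_bigr => k _; rewrite mxE mulrDl. Qed.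

Lemma innerZl (t : C) x y : inner (t *: x) y = t * inner x y.
Proof.
by rewrite /inner mulr_sumr; apply: eq_bigr => k _; rewrite mxE mulrA.
Qed.

Lemma inner_conj x y : (inner x y)^* = inner y x.
Proof.
rewrite rmorph_sum; apply: eq_bigr => k _.
by rewrite rmorphM/= conjCK mulrC.
Qed.

Lemma innerDr x y z : inner x (y + z) = inner x y + inner x z.
Proof. by rewrite -inner_conj innerDl rmorphD/= !inner_conj. Qed.

Lemma innerZr (t : C) x y : inner x (t *: y) = t^* * inner x y.
Proof. by rewrite -inner_conj innerZl rmorphM/= inner_conj. Qed.

Lemma innerNl x y : inner (- x) y = - inner x y.
Proof. by rewrite -scaleN1r innerZl mulN1r. Qed.

Lemma innerNr x y : inner x (- y) = - inner x y.
Proof. by rewrite -inner_conj innerNl rmorphN/= inner_conj. Qed.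

Lemma inner0l x : inner 0 x = 0.
Proof. by rewrite -(scale0r x) innerZl mul0r. Qed.

Lemma inner0r x : inner x 0 = 0.
Proof. by rewrite -inner_conj inner0l rmorph0. Qed.

Definition innerE := (innerDl, innerDr, innerNl, innerNr, innerZl, innerZr).

Lemma Re_inner_sum x : Re (inner x x) = \sum_(k < m) nrm (x k 0) ^+ 2.
Proof.
rewrite /inner (big_morph Re (@Re_add R) (erefl _)); apply: eq_bigr => k _.
by rewrite mulC_conj.
Qed.

Lemma enorm_sqr x : enorm x ^+ 2 = Re (inner x x).
Proof. by rewrite sqr_sqrtr// Re_inner_sum sumr_ge0// => k _; rewrite sqr_ge0. Qed.

Lemma inner_self x : inner x x = (enorm x ^+ 2)%:C%C.
Proof.
rewrite enorm_sqr Re_inner_sum rmorph_sum/=; apply: eq_bigr => k _.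
by rewrite mulC_conj.
Qed.

Lemma enorm_ge0 x : 0 <= enorm x.
Proof. exact: sqrtr_ge0. Qed.

Lemma nrm_entry_le x k : nrm (x k 0) <= enorm x.
Proof.
rewrite -(@ler_pXn2r _ 2) ?nnegrE ?nrm_ge0 ?enorm_ge0// enorm_sqr Re_inner_sum.
by rewrite (bigD1 k)//= lerDl sumr_ge0// => i _; rewrite sqr_ge0.
Qed.

Lemma enorm_eq0 x : (enorm x == 0) = (x == 0).
Proof.
apply/eqP/eqP => [x0|->]; last by rewrite /enorm inner0l sqrtr0.
apply/matrixP => k j; rewrite (ord1 j) mxE; apply: Normc.eq0_normc.
by apply/eqP; rewrite eq_le nrm_ge0 andbT -x0 nrm_entry_le.
Qed.

Lemma enorm0 : enorm (0 : V) = 0.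
Proof. by apply/eqP; rewrite enorm_eq0. Qed.

Lemma enormZ (t : C) x : enorm (t *: x) = nrm t * enorm x.
Proof.
apply/eqP; rewrite -(@eqrXn2 _ 2) ?mulr_ge0 ?enorm_ge0 ?nrm_ge0//; apply/eqP.
rewrite enorm_sqr innerZl innerZr mulrA mulC_conj inner_self -rmorphM/=.
by rewrite exprMn.
Qed.

(** The squared norm of [|y|^2 x - <x, y> y] equals [|y|^2 (|x|^2 |y|^2 - |<x, y>|^2)]. *)
Lemma cauchy_schwarz x y : nrm (inner x y) <= enorm x * enorm y.
Proof.
have [->|y0] := eqVneq y 0; first by rewrite inner0r Normc.normc0 enorm0 mulr0.
have Y0 : 0 < enorm y by rewrite lt0r enorm_eq0 y0 enorm_ge0.
pose c := inner x y; pose Y := enorm y ^+ 2.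
have : 0 <= enorm (Y%:C%C *: x - c *: y) ^+ 2 by rewrite sqr_ge0.
rewrite enorm_sqr !innerE -(inner_conj x y) conj_real -/c !inner_self -/Y.
rewrite (_ : _ + _ = (Y%:C * (Y%:C * (enorm x ^+ 2)%:C - c * c^*))%C); last first.
  by ring.
rewrite mulC_conj -(rmorphM (real_complex R)) -(rmorphB (real_complex R)).
rewrite -(rmorphM (real_complex R))/= pmulr_rge0 ?exprn_gt0//.
rewrite subr_ge0 => H; rewrite -(@ler_pXn2r _ 2) ?nnegrE ?mulr_ge0 ?nrm_ge0 ?enorm_ge0//.
by rewrite exprMn mulrC.
Qed.

Lemma ball_inner_lt1 x y : unit_ball x -> unit_ball y -> nrm (inner x y) < 1.
Proof.
move=> x1 y1; apply: le_lt_trans (cauchy_schwarz x y) _.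
by apply: le_lt_trans y1; rewrite ler_piMl ?enorm_ge0// ltW.
Qed.

Lemma ball_den_neq0 x y : unit_ball x -> unit_ball y -> 1 - inner x y != 0.
Proof.
move=> x1 y1; rewrite subr_eq0; apply/eqP => /(congr1 nrm); rewrite Normc.normc1.
by have := ball_inner_lt1 x1 y1 => /[swap] <-; rewrite ltxx.
Qed.

Lemma ballE x : unit_ball x <-> enorm x ^+ 2 < 1.
Proof.
rewrite /unit_ball/=; split => h; first by rewrite expr_lt1 ?enorm_ge0.
by rewrite -(@expr_lt1 _ 2) ?enorm_ge0.
Qed.

Lemma ball0 : unit_ball (0 : V).
Proof. by rewrite /unit_ball/= enorm0. Qed.

Section Mobius.
Variable a : V.
Hypothesis a1 : unit_ball a.
Local Notation s := (ball_scale a).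

Lemma ball_scale_gt0 : 0 < s.
Proof. by rewrite sqrtr_gt0 subr_gt0 -ballE. Qed.

Lemma ball_scale_sqr : inner a a = 1 - (s%:C%C) ^+ 2.
Proof.
have := ball_scale_gt0; rewrite -rmorphXn/= sqrtr_gt0 => /ltW s0.
by rewrite sqr_sqrtr// inner_self rmorphB/= rmorph1; ring.
Qed.

Lemma ball_scale1_neq0 : 1 + s%:C%C != 0 :> C.
Proof.
rewrite -[1](rmorph1 (real_complex R)) -rmorphD fmorph_eq0 gt_eqF//.
by have := ball_scale_gt0; lra.
Qed.

(** Since [<a, a> = 1 - s^2], the factor [(1 - s) / <a, a>] is [1 / (1 + s)]; this merges the two
    projections and treats [a = 0] uniformly. *)
Lemma ball_mobiusE z : ball_mobius a z = (1 - inner z a)^-1 *: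
  ((1 - inner z a / (1 + s%:C%C)) *: a - s%:C%C *: z).
Proof.
have s0 := ball_scale1_neq0.
rewrite /ball_mobius /ball_coproj /ball_proj; congr (_ *: _).
have [a0|a0] := eqVneq a 0.
  by rewrite a0 scaler0 !subr0.
have A0 : inner a a != 0.
  by rewrite inner_self fmorph_eq0 expf_eq0/= enorm_eq0 a0.
rewrite scalerBr opprB addrA !scalerA; congr (_ - _).
rewrite -addrA -scaleNr -scalerDl -[X in X + _]scale1r -scalerDl; congr (_ *: _).
move: A0; rewrite ball_scale_sqr => A0; field.
by apply/andP.
Qed.

(** With [<a, a>] eliminated, this is a rational identity in [s] and the inner products. The norm
    formula and the invariance of the kernel rest on it. *)
Lemma ball_mobius_inner z w : unit_ball z -> unit_ball w ->
  1 - inner (ball_mobius a z) (ball_mobius a w) =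
  s%:C%C ^+ 2 * (1 - inner z w) / ((1 - inner z a) * (1 - inner a w)).
Proof.
move=> z1 w1; have s0 := ball_scale1_neq0.
rewrite !ball_mobiusE !innerE !(rmorphB, rmorphM, rmorphD, fmorphV, rmorph1)/=.
rewrite !conj_real !inner_conj.
rewrite ball_scale_sqr.
have d1 := ball_den_neq0 z1 a1; have d2 := ball_den_neq0 a1 w1.
by field; apply/and3P.
Qed.

Lemma conj_1inner x y : (1 - inner x y)^* = 1 - inner y x.
Proof. by rewrite rmorphB rmorph1/= inner_conj. Qed.

Lemma nrm_inner_sym x y : nrm (1 - inner x y) = nrm (1 - inner y x).
Proof. by rewrite -conj_1inner -[_^*]/(_^*%C) nrm_conj. Qed.

Lemma ball_scale_enorm : s ^+ 2 = 1 - enorm a ^+ 2.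
Proof. by rewrite sqr_sqrtr// subr_ge0 ltW// -ballE. Qed.

Lemma ball_mobius_enorm z : unit_ball z -> 1 - enorm (ball_mobius a z) ^+ 2 =
  (1 - enorm a ^+ 2) * (1 - enorm z ^+ 2) / nrm (1 - inner z a) ^+ 2.
Proof.
move=> z1; have := ball_mobius_inner z1 z1.
have -> : (1 - inner z a) * (1 - inner a z) = (nrm (1 - inner z a) ^+ 2)%:C%C.
  by rewrite -mulC_conj conj_1inner.
rewrite !inner_self -!(rmorph1 (real_complex R)) -!(rmorphXn (real_complex R)).
rewrite -!(rmorphB (real_complex R)) -!(rmorphM (real_complex R)).
rewrite -(fmorphV (real_complex R)) -!(rmorphM (real_complex R)).
by move=> /complexI; rewrite ball_scale_enorm.
Qed.

Lemma ball_mobius_ball z : unit_ball z -> unit_ball (ball_mobius a z).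
Proof.
move=> z1; apply/ballE; rewrite -subr_gt0 ball_mobius_enorm//.
rewrite divr_gt0 ?exprn_gt0 ?nrm_gt0 ?ball_den_neq0//.
by rewrite mulr_gt0// subr_gt0; apply/ballE.
Qed.

Lemma ball_mobius0 : ball_mobius a 0 = a.
Proof.
by rewrite ball_mobiusE inner0l mul0r !subr0 invr1 scaler0 subr0 !scale1r.
Qed.

Lemma ball_mobius_self : ball_mobius a a = 0.
Proof.
apply/eqP; rewrite -enorm_eq0 -sqrf_eq0 -[_ ^+ 2](subKr 1).
rewrite ball_mobius_enorm// inner_self -(rmorph1 (real_complex R)) -rmorphB.
rewrite nrm_real real_normK ?num_real// -expr2 divff ?subrr//.
by rewrite sqrf_eq0 gt_eqF// subr_gt0; apply/ballE.
Qed.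

Lemma ball_mobiusK z : unit_ball z -> ball_mobius a (ball_mobius a z) = z.
Proof.
move=> z1; have s0 := ball_scale1_neq0.
have d1 := ball_den_neq0 z1 a1.
have sn0 : s%:C%C != 0 :> C by rewrite fmorph_eq0 gt_eqF// ball_scale_gt0.
have E : inner (ball_mobius a z) a = (inner a a - inner z a) / (1 - inner z a).
  by rewrite ball_mobiusE !innerE ball_scale_sqr; field; apply/andP.
rewrite (ball_mobiusE (ball_mobius a z)) E ball_mobiusE ball_scale_sqr.
set t := inner z a in d1 *.
rewrite (_ : 1 - _ / _ = s%:C%C ^+ 2 / (1 - t)); last by field.
rewrite !(scalerBr, scalerA) opprB addrA addrAC -scalerBl.
(* The composite is a combination of [a] and [z], with coefficients 0 and 1. *)
rewrite [X in X *: a](_ : _ = 0); last by field; apply/and3P.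
rewrite [X in X *: z](_ : _ = 1); last by field; apply/andP.
by rewrite scale0r add0r scale1r.
Qed.

End Mobius.

Lemma differentiable_inner (a z : V) :
  differentiable (fun w => inner w a : C^o) (z : (V : normedModType C)).
Proof.
rewrite (_ : (fun w => inner w a) = \sum_(k < m) (fun w : V => w k 0 * (a k 0)^*)).
  apply: differentiable_sum => k.
  apply: (@differentiableM _ _ (fun w : V => w k 0) (cst (a k 0)^*)).
    exact: differentiable_coord.
  exact: differentiable_cst.
by apply/funext => w; rewrite fct_sumE.
Qed.

Lemma ball_mobius_holomorphic a : unit_ball a ->
  holomorphic_on (@unit_ball R m) (ball_mobius a).
Proof.
move=> a1 z z1.
pose g w : C := (1 - inner w a)^-1; pose t := (ball_scale a)%:C%C.
(* Every term becomes a scalar function times a constant vector, so the scalar differentiation rules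
   suffice. *)
rewrite (_ : ball_mobius a = (fun w => (g w * (1 - inner w a * (1 + t)^-1)) *: a -
    \sum_(k < m) (g w * (t * w k 0)) *: (delta_mx k 0 : V))); last first.
  apply/funext => w; rewrite ball_mobiusE// scalerBr !scalerA.
  congr (_ - _); rewrite [X in _ *: X = _](matrix_sum_delta w) scaler_sumr.
  by apply: eq_bigr => k _; rewrite big_ord1 scalerA mulrA.
have dg : differentiable (g : V -> C^o) (z : (V : normedModType C)).
  apply: differentiableV; last exact: ball_den_neq0.
  by apply: differentiableB; [exact: differentiable_cst|exact: differentiable_inner].
have diM (u v : V -> C^o) : differentiable u (z : (V : normedModType C)) ->
    differentiable v (z : (V : normedModType C)) ->
    differentiable (fun w => u w * v w : C^o) (z : (V : normedModType C)).
  by move=> du dv; exact: (differentiableM du dv).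
have dcst (c : C^o) : differentiable (cst c : V -> C^o) (z : (V : normedModType C)).
  exact: differentiable_cst.
have d1 : differentiable (fun w : V => 1 - inner w a * (1 + t)^-1 : C^o)
    (z : (V : normedModType C)).
  exact: (differentiableB (dcst 1)
    (diM _ (cst (1 + t)^-1) (differentiable_inner a z) (dcst _))).
have d2 := differentiableZl a (diM _ _ dg d1).
have d3 k : differentiable (fun w : V => (g w * (t * w k 0)) *: (delta_mx k 0 : V))
    (z : (V : normedModType C)).
  exact: (differentiableZl (delta_mx k 0 : V)
    (diM _ _ dg (diM (cst t) _ (dcst t) (differentiable_coord _ k 0)))).
have dB (u v : V -> V) : differentiable u (z : (V : normedModType C)) ->
    differentiable v (z : (V : normedModType C)) ->
    differentiable (fun w => u w - v w) (z : (V : normedModType C)).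
  by move=> du dv; exact: (differentiableB du dv).
apply: (dB _ _ d2); have := differentiable_sum d3.
set S := (X in differentiable_def X _); rewrite (_ : S = fun w : V =>
  \sum_(k < m) (g w * (t * w k 0)) *: (delta_mx k 0 : V))//.
by apply/funext => w; rewrite /S fct_sumE.
Qed.

Lemma ball_mobius_automorphism a : unit_ball a -> ball_automorphism (ball_mobius a).
Proof.
move=> a1; exists (ball_mobius a); split; try exact: ball_mobius_holomorphic.
- by move=> z z1; split; exact: ball_mobius_ball.
- by move=> z z1; rewrite ball_mobiusK.
Qed.

(** One minus the squared pseudohyperbolic distance; it is the argument of [ln] in [L_N]. *)
Definition ball_kernel z w : R :=
  (1 - enorm z ^+ 2) * (1 - enorm w ^+ 2) / nrm (1 - inner z w) ^+ 2.

Lemma ball_kernel_mobius a z : unit_ball a -> unit_ball z ->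
  ball_kernel a z = 1 - enorm (ball_mobius a z) ^+ 2.
Proof. by move=> a1 z1; rewrite ball_mobius_enorm// /ball_kernel nrm_inner_sym. Qed.

(** Numerator and denominator both gain the factor [s^4 / (|1 - <z, a>|^2 |1 - <w, a>|^2)]. *)
Lemma ball_kernel_invariant a z w : unit_ball a -> unit_ball z -> unit_ball w ->
  ball_kernel (ball_mobius a z) (ball_mobius a w) = ball_kernel z w.
Proof.
move=> a1 z1 w1; rewrite /ball_kernel.
move: (ball_mobius_enorm a1 z1) (ball_mobius_enorm a1 w1).
move: (ball_mobius_inner a1 z1 w1).
move: (ball_mobius a z) (ball_mobius a w) => p q -> -> ->.
rewrite -(ball_scale_enorm a1).
rewrite !Normc.normcM Normc.normcV Normc.normcM (nrm_inner_sym a w).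
have -> : nrm (ball_scale a)%:C%C = ball_scale a.
  by rewrite nrm_real ger0_norm// ltW// ball_scale_gt0.
have s0 : ball_scale a != 0 by rewrite gt_eqF// ball_scale_gt0.
have nz x y : unit_ball x -> unit_ball y -> nrm (1 - inner x y) != 0.
  by move=> x1 y1; rewrite nrm_eq0 ball_den_neq0.
have k1 := nz _ _ z1 a1; have k2 := nz _ _ w1 a1; have k3 := nz _ _ z1 w1.
move: k1 k2 k3 s0; move: (nrm _) (nrm _) (nrm _) (ball_scale a) => x y k s.
move: (1 - enorm z ^+ 2) (1 - enorm w ^+ 2) => A B x0 y0 k0 s0.
by field; rewrite x0 y0 k0 s0.
Qed.

End BallMobius.

(** * Automorphisms of the ball *)

Section BallSchwarz.
Variables (R : realType) (m : nat).
Local Open Scope classical_set_scope.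
Local Open Scope ring_scope.
Local Notation C := R[i].
Local Notation V := 'cV[C]_m.
Local Notation nrm := (@Normc.normc R).
Local Notation Re := (@complex.Re R).
Local Notation Im := (@complex.Im R).
Implicit Types (x y z w a c : V).

(** [D] is the derivative of [f] along [v], carried through the continuous linear functional
    [<., w>]; one [D] thus serves all [w]. *)
Lemma cderiv_line (f : V -> V) (t : C) v :
  differentiable f (t *: v : (V : normedModType C)) ->
  exists D : V, forall w, cderiv (fun u => inner (f (u *: v)) w) t (inner D w).
Proof.
move=> df; have := diff_derivable (v := v) df; rewrite /derivable.
move=> /cvg_ex[/= D fD]; exists D => w e e0.
have cw : {for D, continuous (fun x : (V : normedModType C) => inner x w : C^o)}.
  exact: differentiable_continuous (differentiable_inner w D).
have iD := continuous_cvg _ cw fD.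
have /cvgrPdist_le /(_ e%:C%C) := iD (@dnbhs_filter ((C : numFieldType) : topologicalType) 0).
rewrite ltcR => /(_ e0) /nbhs_ballP[r /= r0 H].
have rE : (Re r)%:C%C = r by rewrite RRe_real// gtr0_real.
exists (Re r); first by rewrite -ltcR rE.
move=> u; rewrite -ltcR rE => ur.
have [->|ut] := eqVneq u t; first by rewrite !subrr mulr0 subr0 Normc.normc0 mulr0.
have := H (u - t); rewrite /ball/= sub0r normrN => /(_ ur).
rewrite subr_eq0 => /(_ ut); rewrite scalerBl subrK innerZl innerDl innerNl.
have ut0 : u - t != 0 by rewrite subr_eq0.
rewrite lecR => {}H.
rewrite (_ : _ - _ - _ = - (inner D w - (u - t)^-1 *
    (inner (f (u *: v)) w - inner (f (t *: v)) w)) * (u - t)); last by field.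
by rewrite Normc.normcM nrmN ler_wpM2r ?nrm_ge0.
Qed.

Lemma cderiv_unique (h : C -> C) (z d d' : C) :
  cderiv h z d -> cderiv h z d' -> d = d'.
Proof.
move=> hd hd'; apply/eqP; rewrite -subr_eq0 -nrm_eq0 eq_le nrm_ge0 andbT.
apply/ler_addgt0Pr => e e0; rewrite add0r; have e2 : 0 < e / 2 by rewrite divr_gt0.
have [r r0 H] := hd _ e2; have [r' r'0 H'] := hd' _ e2.
pose q := Num.min r r' / 2; have q0 : 0 < q by rewrite divr_gt0// lt_min r0.
have qE : z + q%:C%C - z = q%:C%C by rewrite addrC addKr.
have nq : nrm q%:C%C = q by rewrite nrm_real ger0_norm// ltW.
have qlt : q < Num.min r r' by rewrite /q; move: q0; rewrite /q; lra.
move: qlt; rewrite lt_min => /andP[qr qr'].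
have := H (z + q%:C%C); rewrite qE nq => /(_ qr) h1.
have := H' (z + q%:C%C); rewrite qE nq => /(_ qr') h2.
rewrite -(ler_pM2r q0) -{1}nq -Normc.normcM.
rewrite (_ : (d - d') * _ = (h (z + q%:C%C) - h z - d' * q%:C%C) -
  (h (z + q%:C%C) - h z - d * q%:C%C)); last ring.
by apply: le_trans (nrmB _ _) _; lra.
Qed.

Lemma unit_ballZ (t : C) (v : V) : enorm v = 1 -> nrm t < 1 -> unit_ball (t *: v).
Proof. by move=> v1 t1; rewrite /unit_ball/= enormZ v1 mulr1. Qed.

(** Restricting [f] to the complex line through [z] and pairing with the unit vector along [f z]
    gives a self-map of the disc fixing 0, with value [|f z|] at [|z|]. *)
Lemma ball_schwarz (f : V -> V) : holomorphic_on (@unit_ball R m) f ->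
  (forall z, unit_ball z -> unit_ball (f z)) -> f 0 = 0 ->
  forall z, unit_ball z -> enorm (f z) <= enorm z.
Proof.
move=> df fB f0 z z1.
have [->|z0] := eqVneq z 0; first by rewrite f0.
have [->|fz0] := eqVneq (f z) 0; first by rewrite enorm0 enorm_ge0.
have normalize x : x != 0 -> enorm ((enorm x)^-1%:C%C *: x) = 1.
  move=> x0; rewrite enormZ nrm_real ger0_norm ?invr_ge0 ?enorm_ge0//.
  by rewrite mulVf// enorm_eq0.
set v := (enorm z)^-1%:C%C *: z; set w := (enorm (f z))^-1%:C%C *: f z.
have v1 : enorm v = 1 by exact: normalize.
have w1 : enorm w = 1 by exact: normalize.
have zE : (enorm z)%:C%C *: v = z.
  by rewrite scalerA -rmorphM/= divff ?enorm_eq0// scale1r.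
have := @schwarz R (fun t => inner (f (t *: v)) w) (enorm z).
have -> : Re (inner (f ((enorm z)%:C%C *: v)) w) = enorm (f z).
  rewrite zE /w innerZr conj_real inner_self -rmorphM/= expr2.
  by rewrite mulKf ?enorm_eq0.
apply.
- move=> t t1; have [D HD] := cderiv_line (df _ (unit_ballZ v1 t1)).
  by exists (inner D w); exact: HD.
- move=> t t1; apply: le_lt_trans (cauchy_schwarz _ _) _.
  rewrite w1 mulr1; exact: (fB _ (unit_ballZ v1 t1)).
- by rewrite scale0r f0 inner0l.
- by rewrite enorm_ge0.
Qed.

Lemma comp_automorphism (p q : V -> V) : ball_automorphism p ->
  ball_automorphism q -> ball_automorphism (p \o q).
Proof.
move=> [p' [p1 p2 p3 p4]] [q' [q1 q2 q3 q4]]; exists (q' \o p'); split.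
- move=> z z1 /=; split; first by apply: (p1 _ _).1; apply: (q1 _ _).1.
  by apply: (q1 _ _).2; apply: (p1 _ _).2.
- move=> z z1 /=; split.
    by rewrite (p2 _ _).1 ?(q2 _ _).1//; apply: (q1 _ _).1.
  by rewrite (q2 _ _).2 ?(p2 _ _).2//; apply: (p1 _ _).2.
- move=> z z1; apply: differentiable_comp; first exact: q3.
  by apply: p3; apply: (q1 _ _).1.
- move=> z z1; apply: differentiable_comp; first exact: p4.
  by apply: q4; apply: (p1 _ _).2.
Qed.

(** The Schwarz lemma applies to [f] and to its inverse. *)
Lemma automorphism_isometry0 (f : V -> V) : ball_automorphism f -> f 0 = 0 ->
  forall z, unit_ball z -> enorm (f z) = enorm z.
Proof.
move=> [g [fg1 fg2 df dg]] f0 z z1.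
have g0 : g 0 = 0 by rewrite -[in LHS]f0 (fg2 _ (@ball0 R m)).1.
apply/eqP; rewrite eq_le; apply/andP; split.
  by apply: ball_schwarz => // x x1; exact: (fg1 _ x1).1.
rewrite -[in leLHS](fg2 _ z1).1; apply: ball_schwarz => //.
  by move=> x x1; exact: (fg1 _ x1).2.
exact: (fg1 _ z1).1.
Qed.

(** The automorphism [p_(f a) o f o p_a] fixes 0, hence preserves norms, and it sends [p_a z] to
    [p_(f a) (f z)]. *)
Lemma automorphism_kernel (f : V -> V) a z : ball_automorphism f -> f 0 = 0 ->
  unit_ball a -> unit_ball z -> ball_kernel (f a) (f z) = ball_kernel a z.
Proof.
move=> fA f0 a1 z1.
have fa1 : unit_ball (f a) by case: fA => g [fg _ _ _]; exact: (fg _ a1).1.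
have fz1 : unit_ball (f z) by case: fA => g [fg _ _ _]; exact: (fg _ z1).1.
have gA := comp_automorphism (ball_mobius_automorphism fa1)
  (comp_automorphism fA (ball_mobius_automorphism a1)).
have g0 : (ball_mobius (f a) \o (f \o ball_mobius a)) 0 = 0.
  by rewrite /= ball_mobius0// ball_mobius_self.
rewrite (ball_kernel_mobius a1 z1) (ball_kernel_mobius fa1 fz1).
have E : enorm (ball_mobius (f a) (f z)) = enorm (ball_mobius a z).
  have := automorphism_isometry0 gA g0 (ball_mobius_ball a1 z1).
  by rewrite /= (ball_mobiusK a1 z1).
exact: (congr1 (fun r : R => 1 - r ^+ 2) E).
Qed.

(* |1 - <f z, f a>| = |1 - <z, a>| compares the first order terms of the
   holomorphic functions [<f (t v), f a>] and [<t v, a>] of [t] at 0. *)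
Lemma automorphism_inner_derivative (f : V -> V) a v (d : C) :
  ball_automorphism f -> f 0 = 0 -> unit_ball a ->
  cderiv (fun t => inner (f (t *: v)) (f a)) 0 d -> d = inner v a.
Proof.
move=> fA f0 a1 hd; set k := inner v a.
pose F t := inner (f (t *: v)) (f a).
have modE t : unit_ball (t *: v) -> nrm (1 - F t) = nrm (1 - t * k).
  move=> t1; have := automorphism_kernel fA f0 t1 a1.
  have iso := automorphism_isometry0 fA f0.
  have P : (1 - enorm (t *: v) ^+ 2) * (1 - enorm a ^+ 2) != 0.
    by rewrite mulf_neq0// gt_eqF// subr_gt0; apply/ballE.
  rewrite /ball_kernel (iso _ t1) (iso _ a1) => /(mulfI P)/invr_inj/eqP.
  by rewrite eqrXn2 ?nrm_ge0// => /eqP; rewrite innerZl.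
have F0 : F 0 = 0 by rewrite /F scale0r f0 inner0l.
pose n := d - k; apply/eqP; rewrite -subr_eq0 -/n -nrm_eq0 -sqrf_eq0 eq_le sqr_ge0 andbT.
pose N := nrm n; have N0 : 0 <= N by exact: nrm_ge0.
pose K := (nrm d + 1) ^+ 2 * N ^+ 2.
have K0 : 0 <= K by rewrite mulr_ge0 ?sqr_ge0.
have vN0 : 0 <= N * enorm v by rewrite mulr_ge0 ?enorm_ge0.
apply/ler_addgt0Pr => e e0; rewrite add0r.
pose e' := Num.min 1 (e / 2 / (1 + N)).
have e'0 : 0 < e' by rewrite lt_min ltr01 !divr_gt0//; lra.
have e'1 : e' <= 1 by rewrite ge_min lexx.
have e'N : e' * N <= e / 2.
  have : e' <= e / 2 / (1 + N) by rewrite ge_min lexx orbT.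
  rewrite ler_pdivlMr; last lra.
  by apply: le_trans; rewrite ler_pM2l//; lra.
have [r r0 H] := hd _ e'0.
(* The three bounds keep [t] within the radius of the derivative, keep [t v] in the ball, and make
   the second order term [q^2 K] at most [q e]. *)
pose q := Num.min (r / (1 + N)) (Num.min (1 / (1 + N * enorm v)) (e / (1 + K))).
have q0 : 0 < q by rewrite !lt_min !divr_gt0//; lra.
have qr : q * N < r.
  have : q <= r / (1 + N) by rewrite ge_min lexx.
  by rewrite ler_pdivlMr; lra.
have qv : q * N * enorm v < 1.
  have : q <= 1 / (1 + N * enorm v) by rewrite !ge_min lexx orbT.
  by rewrite ler_pdivlMr; lra.
have qK : q * K <= e.
  have : q <= e / (1 + K) by rewrite !ge_min lexx !orbT.
  by rewrite ler_pdivlMr; lra.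
(* This direction makes [Re (n t) = q N^2], so the discrepancy [n] of the two derivatives appears
   undiminished in the real part. *)
pose t := q%:C%C * n^*.
have nt : nrm t = q * N.
  by rewrite Normc.normcM nrm_real gtr0_norm// -[n^*]/(n^*%C) nrm_conj.
have tn : Re (n * t) = q * N ^+ 2.
  by rewrite /t mulrCA mulC_conj -rmorphM.
have := modE t; rewrite /unit_ball/= enormZ nt => /(_ qv) /(congr1 (fun x : R => x ^+ 2)).
have := H t; rewrite -/(F t) -/(F 0) F0 !subr0 nt => /(_ qr).
set eta := F t - d * t => Heta E.
have nF : nrm (F t) <= (nrm d + 1) * (q * N).
  rewrite -(subrK (d * t) (F t)); apply: le_trans (nrmD _ _) _.
  rewrite Normc.normcM nt mulrDl mul1r addrC lerD2l; apply: le_trans Heta _.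
  by rewrite ler_piMl// mulr_ge0// ltW.
have sqF : nrm (F t) ^+ 2 <= q * q * K.
  apply: (@le_trans _ _ (((nrm d + 1) * (q * N)) ^+ 2)).
    by rewrite ler_pXn2r ?nnegrE ?mulr_ge0 ?nrm_ge0 ?addr_ge0 ?nrm_ge0// ltW.
  by rewrite /K le_eqVlt; apply/orP; left; apply/eqP; ring.
have nReta : - Re eta <= e' * (q * N).
  by rewrite -Re_opp; apply: le_trans (Re_le_nrm _) _; rewrite nrmN.
have expand (u : C) : nrm (1 - u) ^+ 2 = 1 - 2 * Re u + nrm u ^+ 2.
  by rewrite !nrm_sqr Re_add Im_add Re_opp Im_opp /=; ring.
have eE : Re (F t) = Re (n * t) + Re (t * k) + Re eta.
  by rewrite -!Re_add /eta /n; congr Re; ring.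
have tk0 : 0 <= nrm (t * k) ^+ 2 by exact: sqr_ge0.
move: E; rewrite !expand eE tn => E.
rewrite -/N -(ler_pM2l q0); apply: (@le_trans _ _ (q * q * K / 2 + e' * (q * N))); first lra.
have : q * (q * K) <= q * e by rewrite ler_pM2l.
have : q * (e' * N) <= q * (e / 2) by rewrite ler_pM2l.
lra.
Qed.

Lemma inner_delta_l k x : inner (delta_mx k 0) x = (x k 0)^*.
Proof.
rewrite /inner (bigD1 k)//= mxE !eqxx mul1r big1 ?addr0// => i ik.
by rewrite mxE (negPf ik) mul0r.
Qed.

(** The columns [D k] of [f' 0] satisfy [<D k, f a> = <e_k, a>] for all [a] in the ball.
    Differentiating at 0 along [e_j] makes them orthonormal, and the relation itself says that the
    adjoint of [U] inverts [f]. *)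
Lemma automorphism_fix0_unitary (f : V -> V) : ball_automorphism f -> f 0 = 0 ->
  exists2 U : 'M[C]_m, U \is unitarymx & forall z, unit_ball z -> f z = U *m z.
Proof.
move=> fA f0; have df : holomorphic_on (@unit_ball R m) f by case: fA => g [].
have /choice[D HD] : forall k : 'I_m, exists D : V, forall w,
    cderiv (fun t => inner (f (t *: delta_mx k 0)) w) 0 (inner D w).
  move=> k; apply: cderiv_line; apply: df; rewrite scale0r; exact: ball0.
have Df k a : unit_ball a -> inner (D k) (f a) = (a k 0)^*.
  move=> a1; rewrite -inner_delta_l.
  exact: automorphism_inner_derivative fA f0 a1 (HD k (f a)).
have DD j k : inner (D j) (D k) = (j == k)%:R.
  apply: (cderiv_unique (HD j (D k))).
  have := @cderiv_affine R 0 (j == k)%:R 0.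
  apply: cderiv_eq_near ltr01 _ => t; rewrite subr0 => t1.
  have tj1 : unit_ball (t *: (delta_mx j 0 : V)).
    apply: unit_ballZ t1; rewrite /enorm inner_delta_l mxE !eqxx.
    by rewrite rmorph1 sqrtr1.
  rewrite add0r -inner_conj Df// conjCK !mxE eqxx andbT mulrC.
  by rewrite (eq_sym k j).
pose U : 'M[C]_m := \matrix_(i, k) D k i 0.
have UU : map_mx Num.conj U^T *m U = 1%:M.
  apply/matrixP => k j; rewrite !mxE eq_sym -DD.
  by apply: eq_bigr => i _; rewrite !mxE mulrC.
exists U; first by apply/unitarymxP; apply: mulmx1C.
move=> z z1; rewrite -[LHS]mul1mx -(mulmx1C UU) -mulmxA; congr (_ *m _).
apply/matrixP => k j; rewrite (ord1 j) -[RHS]conjCK -Df// inner_conj.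
by rewrite mxE; apply: eq_bigr => i _; rewrite !mxE mulrC.
Qed.

(** With [c] the preimage of 0, [p o p_c] fixes 0 and so is unitary; [p_c] is its own inverse. *)
Lemma automorphism_mobius (p : V -> V) : ball_automorphism p ->
  exists (c : V) (U : 'M[C]_m), [/\ unit_ball c, U \is unitarymx
    & forall w, unit_ball w -> p w = U *m ball_mobius c w].
Proof.
move=> pA; have [q [pq1 pq2 dp dq]] := pA.
pose c := q 0; have c1 : unit_ball c by exact: (pq1 _ (@ball0 R m)).2.
have [|U UU HU] := automorphism_fix0_unitary
    (comp_automorphism pA (ball_mobius_automorphism c1)).
  by rewrite /= ball_mobius0// (pq2 _ (@ball0 R m)).2.
exists c, U; split => // w w1.
by rewrite -(HU _ (ball_mobius_ball c1 w1)) /= (ball_mobiusK c1 w1).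
Qed.

End BallSchwarz.

(** * The logarithmic barycenter function *)

Section LogBarycenter.
Variables (R : realType) (m : nat).
Local Notation C := R[i].
Local Notation V := 'cV[C]_m.
Local Notation nrm := (@Normc.normc R).
Local Notation Re := (@complex.Re R).
Local Notation Im := (@complex.Im R).
Implicit Types (x y z w a c : V).

Lemma ln_lt_sub1 (r : R) : 0 < r -> r != 1 -> ln r < r - 1.
Proof.
move=> r0 r1; have : ln r != 0 by rewrite ln_eq0.
by move=> /expR_gt1Dx; rewrite lnK//; lra.
Qed.

Lemma ln_le_sub1 (r : R) : 0 < r -> ln r <= r - 1.
Proof. by move=> r0; have := @le_ln1Dx _ (r - 1); rewrite subrKC; apply; lra. Qed.

(* [1 - t s] is a convex combination of [1 - t] and [1 + t], so strict
   concavity of [ln] bounds this function of [s] below by its chord. *)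
Lemma ln_chord_lt (t s : R) : 0 < t < 1 -> -1 < s < 1 ->
  - s * (ln (1 + t) - ln (1 - t)) < ln ((1 - t * s) ^+ 2) - ln (1 - t ^+ 2).
Proof.
move=> /andP[t0 t1] /andP[s0 s1].
have ts : 0 < 1 - t * s by nra.
have P1 : 0 < 1 - t by lra.
have P2 : 0 < 1 + t by lra.
have -> : 1 - t ^+ 2 = (1 - t) * (1 + t) by ring.
rewrite lnXn// lnM ?posrE// mulr2n.
(* Strict concavity comes from [ln r < r - 1] at the two ratios; with weights [1 + s] and [1 - s]
   the right sides sum to 0. *)
have E1 : ln (1 - t) - ln (1 - t * s) < (1 - t) / (1 - t * s) - 1.
  rewrite -ln_div ?posrE//; apply: ln_lt_sub1; first by rewrite divr_gt0.
  by rewrite lt_eqF// ltr_pdivrMr// mul1r; nra.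
have E2 : ln (1 + t) - ln (1 - t * s) < (1 + t) / (1 - t * s) - 1.
  rewrite -ln_div ?posrE//; apply: ln_lt_sub1; first by rewrite divr_gt0.
  by rewrite gt_eqF// ltr_pdivlMr// mul1r; nra.
have H1 : (1 + s) * (ln (1 - t) - ln (1 - t * s)) <
    (1 + s) * ((1 - t) / (1 - t * s) - 1) by rewrite ltr_pM2l//; lra.
have H2 : (1 - s) * (ln (1 + t) - ln (1 - t * s)) <
    (1 - s) * ((1 + t) / (1 - t * s) - 1) by rewrite ltr_pM2l//; lra.
have E : (1 + s) * ((1 - t) / (1 - t * s) - 1) +
    (1 - s) * ((1 + t) / (1 - t * s) - 1) = 0 by field; rewrite gt_eqF.
lra.
Qed.

Lemma log_barycenter_funE N (zs : 'I_N -> V) z :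
  log_barycenter_fun zs z = - \sum_(i < N) ln (ball_kernel z (zs i)).
Proof. by []. Qed.

Lemma ball_kernel_gt0 z w : unit_ball z -> unit_ball w -> 0 < ball_kernel z w.
Proof.
move=> z1 w1; rewrite /ball_kernel divr_gt0 ?exprn_gt0 ?nrm_gt0 ?ball_den_neq0//.
by rewrite mulr_gt0// subr_gt0; apply/ballE.
Qed.

(** The constants [ln (1 - |z_i|^2)] cancel in the difference. *)
Lemma log_barycenter_fun_sub0 N (zs : 'I_N -> V) w :
  (forall i, unit_ball (zs i)) -> unit_ball w ->
  log_barycenter_fun zs w - log_barycenter_fun zs 0 =
  \sum_(i < N) (ln (nrm (1 - inner w (zs i)) ^+ 2) - ln (1 - enorm w ^+ 2)).
Proof.
move=> zs1 w1; rewrite !log_barycenter_funE opprK addrC -sumrB.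
apply: eq_bigr => i _.
have zi1 := zs1 i; have k0 : 0 < nrm (1 - inner w (zs i)) ^+ 2.
  by rewrite exprn_gt0// nrm_gt0 ball_den_neq0.
have sq1 (x : V) : unit_ball x -> 0 < 1 - enorm x ^+ 2.
  by rewrite subr_gt0 => /ballE.
rewrite /ball_kernel inner0l subr0 Normc.normc1 expr1n divr1 enorm0.
rewrite [0 ^+ 2]expr0n/= subr0 mul1r.
have lnE (A B K : R) : 0 < A -> 0 < B -> 0 < K -> ln B - ln (A * B / K) = ln K - ln A.
  move=> A0 B0 K0; rewrite ln_div ?posrE//; last exact: mulr_gt0.
  by rewrite lnM ?posrE//; ring.
exact: lnE (sq1 _ w1) (sq1 _ zi1) k0.
Qed.

(** Moving the points by the involution [p_c] amounts to moving the variable; this transports a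
    minimum between [c] and 0. *)
Lemma log_barycenter_fun_mobius N (zs : 'I_N -> V) c w :
  (forall i, unit_ball (zs i)) -> unit_ball c -> unit_ball w ->
  log_barycenter_fun (fun i => ball_mobius c (zs i)) w =
  log_barycenter_fun zs (ball_mobius c w).
Proof.
move=> zs1 c1 w1; rewrite !log_barycenter_funE; congr (- _).
apply: eq_bigr => i _; congr ln.
by rewrite -(ball_kernel_invariant c1 w1 (ball_mobius_ball c1 (zs1 i)))
  (ball_mobiusK c1 (zs1 i)).
Qed.

(** Replacing [|1 - <w, y_i>|] by its real part [1 - t s_i] only lowers a term, and the chord bounds
    are linear in the [s_i], whose sum vanishes. *)
Lemma log_barycenter_fun_gt0 N (ys : 'I_N -> V) w : (0 < N)%N ->
  (forall i, unit_ball (ys i)) -> \sum_(i < N) ys i = 0 ->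
  unit_ball w -> w != 0 -> log_barycenter_fun ys 0 < log_barycenter_fun ys w.
Proof.
move=> N0 ys1 sum0 w1 w0; rewrite -subr_gt0 log_barycenter_fun_sub0//.
pose t := enorm w; have t0 : 0 < t by rewrite lt0r enorm_eq0 w0 enorm_ge0.
have t1 : t < 1 by [].
pose s i := Re (inner w (ys i)) / t.
have sE i : Re (inner w (ys i)) = t * s i by rewrite /s mulrC divfK// gt_eqF.
have s1 i : -1 < s i < 1.
  rewrite -ltr_norml /s normrM normfV (gtr0_norm t0) ltr_pdivrMr// mul1r.
  apply: le_lt_trans (normr_Re_le _) _; apply: le_lt_trans (cauchy_schwarz _ _) _.
  by rewrite -[X in _ < X]mulr1 -/t ltr_pM2l//; exact: ys1.
have sum_s : \sum_(i < N) s i = 0.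
  rewrite /s -mulr_suml -(big_morph Re (@Re_add R) (erefl : Re 0 = 0)).
  suff -> : \sum_(i < N) inner w (ys i) = 0 by rewrite mul0r.
  have innerw0 := inner0r w.
  by rewrite -(big_morph (inner w) (@innerDr R m w) innerw0) sum0 inner0r.
apply: (@le_lt_trans _ _ (\sum_(i < N) (- s i * (ln (1 + t) - ln (1 - t))))).
  by rewrite -mulr_suml sumrN sum_s oppr0 mul0r.
apply: ltr_sum; first by apply/hasP; exists (Ordinal N0); rewrite ?mem_index_enum.
move=> i _; apply: lt_le_trans (ln_chord_lt _ (s1 i)) _; first by rewrite t0.
have k0 : 0 < nrm (1 - inner w (ys i)) by rewrite nrm_gt0 ball_den_neq0.
have ts : 0 < 1 - t * s i by have := s1 i; nra.
rewrite lerD2r ler_ln ?posrE ?exprn_gt0// nrm_sqr Re_add Re_opp /= sE.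
by rewrite lerDl sqr_ge0.
Qed.

(** If the sum [Y] were nonzero, a short step from 0 along [Y] would lower the function. *)
Lemma log_barycenter_fun_min0 N (ys : 'I_N -> V) : (0 < N)%N ->
  (forall i, unit_ball (ys i)) ->
  (forall w, unit_ball w -> log_barycenter_fun ys 0 <= log_barycenter_fun ys w) ->
  \sum_(i < N) ys i = 0.
Proof.
move=> N0 ys1 min0; apply/eqP; apply: contrapT => /negP Y0.
set Y := \sum_(i < N) ys i in Y0.
pose Q := enorm Y ^+ 2; have Q0 : 0 < Q by rewrite exprn_gt0// lt0r enorm_eq0 Y0 enorm_ge0.
have n0 : 1 <= N%:R :> R by rewrite ler1n.
(* With [t = 1 / P], [t N < 1 / 2]: the gain [2 t Q] then exceeds the cost [3 N t^2 Q], and [|w|^2]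
   stays below [1 / 2]. *)
pose P : R := 2 * N%:R * (1 + Q).
have P0 : 0 < P by rewrite !mulr_gt0//; lra.
pose t := P^-1; have t0 : 0 < t by rewrite invr_gt0.
have tP : 2 * (t * N%:R) + 2 * (t * N%:R * Q) = 1.
  by rewrite -[RHS](mulVf (lt0r_neq0 P0)) -/t /P; ring.
have tN0 : 0 < t * N%:R by rewrite mulr_gt0//; lra.
have tNQ0 : 0 < t * N%:R * Q by rewrite mulr_gt0.
have tQ : t * Q <= t * N%:R * Q by rewrite mulrAC ler_peMr// ltW// mulr_gt0.
have t1 : t <= t * N%:R by rewrite ler_peMr// ltW.
pose w := t%:C%C *: Y.
have wE : enorm w ^+ 2 = t ^+ 2 * Q.
  by rewrite /w enormZ exprMn nrm_real real_normK ?num_real.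
have w2 : enorm w ^+ 2 < 1 / 2.
  by rewrite wE expr2 -mulrA; nra.
have w1 : unit_ball w by apply/ballE; lra.
have := min0 _ w1; rewrite -subr_ge0 log_barycenter_fun_sub0//; apply/negP.
rewrite -ltNge.
(* One part bounds [|<w, y_i>|^2], the other two bound [- ln (1 - |w|^2)]. *)
pose b := 3 * (t ^+ 2 * Q).
apply: (@le_lt_trans _ _ (\sum_(i < N) (b - 2 * t * Re (inner Y (ys i))))).
  apply: ler_sum => i _.
  have k0 : 0 < nrm (1 - inner w (ys i)) by rewrite nrm_gt0 ball_den_neq0.
  have L1 : ln (nrm (1 - inner w (ys i)) ^+ 2) <= t ^+ 2 * Q - 2 * t * Re (inner Y (ys i)).
    apply: le_trans (ln_le_sub1 _) _; first by rewrite exprn_gt0.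
    have : nrm (inner w (ys i)) ^+ 2 <= t ^+ 2 * Q.
      rewrite -wE ler_pXn2r ?nnegrE ?nrm_ge0 ?enorm_ge0//.
      apply: le_trans (cauchy_schwarz _ _) _; rewrite ler_piMr ?enorm_ge0//.
      by rewrite ltW//; exact: ys1.
    have : Re (inner w (ys i)) = t * Re (inner Y (ys i)).
      by rewrite innerZl Re_mul/= mul0r subr0.
    by rewrite !nrm_sqr Re_add Im_add Re_opp Im_opp /=; lra.
  have L2 : - ln (1 - enorm w ^+ 2) <= 2 * (t ^+ 2 * Q).
    rewrite -wE; move: w2; have := sqr_ge0 (enorm w).
    move: (enorm w ^+ 2) => r r0 r2; have r1 : 0 < 1 - r by lra.
    rewrite -lnV ?posrE//; apply: le_trans (ln_le_sub1 _) _; first by rewrite invr_gt0.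
    by rewrite lerBlDr -[_^-1]mul1r ler_pdivrMr//; nra.
  by rewrite /b; lra.
rewrite sumrB sumr_const card_ord -mulr_sumr.
rewrite -(big_morph Re (@Re_add R) (erefl : Re 0 = 0)).
rewrite -(big_morph (inner Y) (@innerDr R m Y) (inner0r Y)) -/Y -enorm_sqr -/Q.
rewrite /b.
have tQ0 : 0 < t * Q by rewrite mulr_gt0.
have tN1 : t * N%:R * 2 < 1 by lra.
have : t * N%:R * 2 * (t * Q) < 1 * (t * Q) by rewrite ltr_pM2r.
rewrite expr2.
lra.
Qed.

End LogBarycenter.

(** * Pointwise continuity of sums and products of real functions *)

Section RealContinuity.
Variables (R : realType) (T : topologicalType).
Local Open Scope classical_set_scope.
Local Open Scope ring_scope.
Implicit Types (f g : T -> R) (x : T).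

Lemma continuous_at_add f g x : {for x, continuous f} -> {for x, continuous g} ->
  {for x, continuous (fun y => f y + g y)}.
Proof. by move=> cf cg; exact: cvgD cf cg. Qed.

Lemma continuous_at_mul f g x : {for x, continuous f} -> {for x, continuous g} ->
  {for x, continuous (fun y => f y * g y)}.
Proof. by move=> cf cg; exact: cvgM cf cg. Qed.

Lemma continuous_at_cst (r : R) x : {for x, continuous (fun=> r)}.
Proof. exact: cst_continuous. Qed.

Lemma continuous_at_sum n (f : 'I_n -> T -> R) x :
  (forall i, {for x, continuous (f i)}) ->
  {for x, continuous (fun y => \sum_(i < n) f i y)}.
Proof.
by move=> cf; apply: cvg_big => [|i _]; [exact: add_continuous|exact: cf].
Qed.

End RealContinuity.

(** * Existence of a minimum by compactness in real coordinates *)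

Section Existence.
Variables (R : realType) (m : nat).
Local Open Scope classical_set_scope.
Local Open Scope ring_scope.
Local Notation C := R[i].
Local Notation V := 'cV[C]_m.
Local Notation W := ('rV[R]_(m + m) : topologicalType).
Local Notation nrm := (@Normc.normc R).
Local Notation Re := (@complex.Re R).
Local Notation Im := (@complex.Im R).
Implicit Types (z w a c : V) (x y : 'rV[R]_(m + m)).

(** Real parts fill the left half of the row and imaginary parts the right half; compactness is then
    that of boxes in a real space. *)
Definition realified x : V :=
  \col_k (x 0 (lshift m k) +i* x 0 (rshift m k))%C.

Lemma realified_surj z : exists x, realified x = z.
Proof.
exists (row_mx (\row_k Re (z k 0)) (\row_k Im (z k 0))).
apply/matrixP => k j; rewrite (ord1 j) mxE row_mxEl row_mxEr !mxE.
by case: (z k 0).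
Qed.

Lemma enorm_realified x : enorm (realified x) ^+ 2 = \sum_j x 0 j ^+ 2.
Proof.
rewrite enorm_sqr Re_inner_sum big_split_ord/= -big_split/=.
by apply: eq_bigr => k _; rewrite mxE nrm_sqr.
Qed.

Lemma continuous_Re_inner_realified a (x : W) :
  {for x, continuous (fun y : W => Re (inner (realified y) a))}.
Proof.
rewrite (_ : (fun y => _) = fun y : W => \sum_(k < m)
   (y 0 (lshift m k) * Re (a k 0) + y 0 (rshift m k) * Im (a k 0))).
  apply: continuous_at_sum => k.
  by apply: continuous_at_add; apply: continuous_at_mul;
    [exact: coord_continuous|exact: continuous_at_cst
    |exact: coord_continuous|exact: continuous_at_cst].
apply/funext => y; rewrite /inner (big_morph Re (@Re_add R) (erefl : Re 0 = 0)).
by apply: eq_bigr => k _; rewrite mxE -[_^*]/(_^*%C); case: (a k 0) => p q /=; ring.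
Qed.

(** [Im <y, a>] is [Re <y, i a>]. *)
Lemma continuous_Im_inner_realified a (x : W) :
  {for x, continuous (fun y : W => Im (inner (realified y) a))}.
Proof.
rewrite (_ : (fun y => _) = fun y : W => Re (inner (realified y) ('i%C *: a))).
  exact: continuous_Re_inner_realified.
by apply/funext => y; rewrite innerZr Re_mul -[_^*]/(_^*%C) /=; ring.
Qed.

Lemma continuous_enorm_realified (x : W) :
  {for x, continuous (fun y : W => enorm (realified y) ^+ 2)}.
Proof.
rewrite (_ : (fun y => _) = fun y : W => \sum_j y 0 j * y 0 j); last first.
  by apply/funext => y; rewrite enorm_realified.
apply: continuous_at_sum => k.
by apply: continuous_at_mul; exact: coord_continuous.
Qed.

Lemma continuous_log_barycenter_fun N (zs : 'I_N -> V) (x : W) :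
  (forall i, unit_ball (zs i)) -> unit_ball (realified x) ->
  {for x, continuous (fun y : W => log_barycenter_fun zs (realified y))}.
Proof.
move=> zs1 x1; apply: continuousN; apply: continuous_at_sum => i.
apply: (@continuous_comp _ _ _ (fun y : W => ball_kernel (realified y) (zs i)) (@ln R));
  last exact/continuous_ln/ball_kernel_gt0.
have cB (f : W -> R) : {for x, continuous f} -> {for x, continuous (fun y => 1 - f y)}.
  by move=> cf; apply: continuous_at_add (continuousN cf); exact: continuous_at_cst.
rewrite /ball_kernel; apply: continuous_at_mul.
  apply: continuous_at_mul; last exact: continuous_at_cst.
  by apply: cB; exact: continuous_enorm_realified.
apply: continuousV; first by rewrite expf_eq0/= nrm_eq0 ball_den_neq0.
rewrite (_ : (fun y => _) = fun y : W =>
   (1 - Re (inner (realified y) (zs i))) * (1 - Re (inner (realified y) (zs i)))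
   + Im (inner (realified y) (zs i)) * Im (inner (realified y) (zs i))); last first.
  by apply/funext => y; rewrite nrm_sqr Re_add Im_add Re_opp Im_opp/= sub0r sqrrN.
by apply: continuous_at_add; apply: continuous_at_mul;
  try exact: continuous_Im_inner_realified;
  apply: cB; exact: continuous_Re_inner_realified.
Qed.

(** Outside a compact ball around 0 the function is at least its value at 0, so the minimum over
    that ball is global. *)
Lemma log_barycenter_fun_min N (zs : 'I_N -> V) : (forall i, unit_ball (zs i)) ->
  exists2 c, unit_ball c & forall z, unit_ball z ->
    log_barycenter_fun zs c <= log_barycenter_fun zs z.
Proof.
move=> zs1; pose r := \big[Num.max/0]_(i < N) enorm (zs i).
have r0 : 0 <= r.
  rewrite /r; elim/big_ind: _ => // [u v u0 v0|i _]; last exact: enorm_ge0.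
  by rewrite le_max u0.
have r1 : r < 1.
  rewrite /r; elim/big_ind: _ => // [u v u0 v0|i _]; last exact: zs1.
  by rewrite gt_max u0.
have zr i : enorm (zs i) <= r by exact: le_bigmax.
(* If [|z|^2 > rho], then [1 - |z|^2 < (1 - r)^2 <= |1 - <z, z_i>|^2], so no term drops below its
   value at 0. *)
pose rho := 1 - (1 - r) ^+ 2.
have rho0 : 0 <= rho by rewrite /rho; nra.
have rho1 : rho < 1 by rewrite /rho; nra.
pose K : set W := [set x : W | enorm (realified x) ^+ 2 <= rho].
have K0 : K 0.
  rewrite /K/= enorm_realified big1// => j _; by rewrite mxE expr0n.
have Kball x : K x -> unit_ball (realified x).
  by move=> Kx; apply/ballE; apply: le_lt_trans rho1.
have cK : compact K.
  apply: (@subclosed_compact W K [set x : W | forall j, `[-1, 1]%classic (x ord0 j)]).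
  - rewrite (_ : K = (fun x => enorm (realified x) ^+ 2) @^-1` [set y | y <= rho])//.
    apply: closed_comp; last exact: closed_le.
    by move=> x _; exact: continuous_enorm_realified.
  - by apply: (@rV_compact R _ (fun=> `[-1, 1]%classic)) => j; exact: segment_compact.
  - move=> x; rewrite /K/= enorm_realified => Kx j.
    rewrite in_itv/= -ler_norml -(@ler_pXn2r _ 2)// ?nnegrE// real_normK ?num_real//.
    rewrite expr1n; apply: le_trans (ltW rho1); apply: le_trans Kx.
    by rewrite (bigD1 j)//= lerDl sumr_ge0// => i _; rewrite sqr_ge0.
have [||c] := compact_EVT_min (f := fun x => log_barycenter_fun zs (realified x)) _ cK.
- by exists 0.
- apply: continuous_in_subspaceT => x /[1!inE] Kx.
  by apply: continuous_log_barycenter_fun => //; exact: Kball.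
rewrite inE => Kc cmin; exists (realified c); first exact: Kball.
move=> z z1; have [x xz] := realified_surj z.
have [zK|Kz] := leP (enorm z ^+ 2) rho.
  by rewrite -xz; apply: cmin; rewrite inE /K/= xz.
have realified0 : realified 0 = 0.
  by apply/matrixP => k j; rewrite !mxE.
apply: le_trans (cmin 0 _) _; first by rewrite inE.
rewrite realified0 -subr_ge0 log_barycenter_fun_sub0// sumr_ge0// => i _.
rewrite subr_ge0 ler_ln ?posrE ?exprn_gt0 ?nrm_gt0 ?ball_den_neq0 ?subr_gt0//; last first.
  exact/ballE.
apply: (@le_trans _ _ ((1 - r) ^+ 2)); first by rewrite /rho in Kz; lra.
have ri : 1 - r <= nrm (1 - inner z (zs i)).
  have h1 := nrmD (1 - inner z (zs i)) (inner z (zs i)).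
  have h2 : nrm (inner z (zs i)) <= r.
    apply: le_trans (cauchy_schwarz _ _) _; apply: le_trans (zr i).
    by rewrite ler_piMl ?enorm_ge0//; exact: ltW.
  by rewrite subrK Normc.normc1 in h1; lra.
by rewrite ler_pXn2r ?nnegrE ?nrm_ge0//; lra.
Qed.

End Existence.

(** * Centers of the given points as minimizers *)

Section Center.
Variables (R : realType) (m N : nat) (zs : 'I_N -> 'cV[R[i]]_m).
Hypotheses (N0 : (0 < N)%N) (zs1 : forall k, unit_ball (zs k)).

(** For the images [p_c (z_k)] the strict minimum is at 0, and [p_c] carries it to [c]. *)
Lemma mobius_center_unique_minimizer c : unit_ball c ->
  \sum_(k < N) ball_mobius c (zs k) = 0 ->
  unique_minimizer (@unit_ball R m) (log_barycenter_fun zs) c.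
Proof.
move=> c1 sum0.
have ys1 k : unit_ball (ball_mobius c (zs k)) by exact: ball_mobius_ball.
have Lc z : unit_ball z -> z != c ->
    log_barycenter_fun zs c < log_barycenter_fun zs z.
  move=> z1 zc; have w1 := ball_mobius_ball c1 z1.
  have w0 : ball_mobius c z != 0.
    apply: contraNneq zc => w0.
    by rewrite -(ball_mobiusK c1 z1) w0 ball_mobius0.
  have := log_barycenter_fun_gt0 N0 ys1 sum0 w1 w0.
  rewrite (log_barycenter_fun_mobius zs1 c1 (@ball0 R m)) (ball_mobius0 c1).
  by rewrite (log_barycenter_fun_mobius zs1 c1 w1) (ball_mobiusK c1 z1).
split=> // [z z1|z z1 zmin].
  by have [->//|zc] := eqVneq z c; exact/ltW/Lc.
apply/eqP/negPn/negP => zc; have := Lc z z1 zc.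
by rewrite ltNge zmin.
Qed.

(** For a minimizer [c], invariance puts the minimum for the images [p_c (z_k)] at 0, where the
    first variation applies. *)
Lemma mobius_center_exists :
  exists2 c, unit_ball c & \sum_(k < N) ball_mobius c (zs k) = 0.
Proof.
have [c c1 cmin] := log_barycenter_fun_min zs1; exists c => //.
apply: log_barycenter_fun_min0 => // [k|w w1]; first exact: ball_mobius_ball.
rewrite (log_barycenter_fun_mobius zs1 c1 (@ball0 R m)) (ball_mobius0 c1).
rewrite (log_barycenter_fun_mobius zs1 c1 w1).
exact/cmin/ball_mobius_ball.
Qed.

Lemma mobius_decomposition_sum0 (p : 'cV[R[i]]_m -> 'cV[R[i]]_m) c U :
  U \is unitarymx -> (forall w, unit_ball w -> p w = U *m ball_mobius c w) ->
  \sum_(k < N) p (zs k) = 0 -> \sum_(k < N) ball_mobius c (zs k) = 0.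
Proof.
move=> UU pE sum0; apply: (can_inj (mulKmx (unitarymx_unit UU))).
rewrite mulmx0 mulmx_sumr -[RHS]sum0; apply: eq_bigr => k _.
by rewrite pE.
Qed.

End Center.

Theorem corollary5p4 (R : realType) (m N : nat) (hm : (0 < m)%N)
    (hN : (0 < N)%N) (zs : 'I_N -> 'cV[R[i]]_m)
    (hzs : forall k : 'I_N, unit_ball (zs k)) :
  (* (1) existence, and uniqueness up to a linear unitary transformation *)
  ((exists p : 'cV[R[i]]_m -> 'cV[R[i]]_m,
      ball_automorphism p /\ \sum_(k < N) p (zs k) = 0)
   /\
   (forall p q : 'cV[R[i]]_m -> 'cV[R[i]]_m,
      ball_automorphism p -> \sum_(k < N) p (zs k) = 0 ->
      ball_automorphism q -> \sum_(k < N) q (zs k) = 0 ->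
      exists U : 'M[R[i]]_m, U \is unitarymx /\
        forall w : 'cV[R[i]]_m, unit_ball w -> q w = U *m p w))
  /\
  (* (2) p decomposes as U o p_c, and c is the unique minimum of L_N *)
  (forall p : 'cV[R[i]]_m -> 'cV[R[i]]_m,
      ball_automorphism p -> \sum_(k < N) p (zs k) = 0 ->
      (exists (c : 'cV[R[i]]_m) (U : 'M[R[i]]_m),
         [/\ unit_ball c, U \is unitarymx
           & forall w : 'cV[R[i]]_m, unit_ball w -> p w = U *m ball_mobius c w])
      /\
      (forall (c : 'cV[R[i]]_m) (U : 'M[R[i]]_m),
         unit_ball c -> U \is unitarymx ->
         (forall w : 'cV[R[i]]_m, unit_ball w -> p w = U *m ball_mobius c w) ->
         unique_minimizer (@unit_ball R m) (log_barycenter_fun zs) c)).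
Proof.
split; first split.
- have [c c1 sum0] := mobius_center_exists hN hzs.
  by exists (ball_mobius c); split => //; exact: ball_mobius_automorphism.
- move=> p q pA psum qA qsum.
  have [c [U [c1 UU pE]]] := automorphism_mobius pA.
  have [d [V [d1 VV qE]]] := automorphism_mobius qA.
  (* Both centers minimize the same function, so [d = c] and the two maps differ by [V] times the
     inverse of [U]. *)
  have [_ _ cU] := mobius_center_unique_minimizer hN hzs c1
    (mobius_decomposition_sum0 hzs UU pE psum).
  have [_ dmin _] := mobius_center_unique_minimizer hN hzs d1
    (mobius_decomposition_sum0 hzs VV qE qsum).
  exists (V *m invmx U); split.
    rewrite (invmx_unitary UU); apply: mul_unitarymx VV _.
    by rewrite trmxC_unitary UU.
  move=> w w1; rewrite (qE _ w1) (pE _ w1) (cU d d1 dmin).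
  by rewrite -mulmxA (mulKmx (unitarymx_unit UU)).
- move=> p pA psum; split; first exact: automorphism_mobius.
  move=> c U c1 UU pE; exact (mobius_center_unique_minimizer hN hzs c1
    (mobius_decomposition_sum0 hzs UU pE psum)).
Qed.
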